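(* Let $(\mathbb T^2,g)$ be a two-dimensional Riemannian torus and $m\ge1$. If $(\mathbb T^2,g)$ admits a real irreducible rank $m$ Killing tensor field, then $Z^{m-1,c}$ is a potential tensor field for some constant real pseudovector $c\neq0$ of weight $m$. Conversely, assume $(\mathbb T^2,g)$ admits no irreducible Killing tensor fields of ranks $1,\dots,m-1$ (no condition if $m=1$). If $Z^{m-1,c}$ is potential for some constant pseudovector $c\neq0$ of weight $m$, then there exists an irreducible rank $m$ Killing tensor field on the torus.
   Context: Symmetric tensor fields on a Riemannian manifold, product $fh=\sigma(f\otimes h)$, $d=\sigma\nabla$ (symmetrized Levi-Civita covariant derivative). $f$ is Killing if $df=0$; a Killing field of rank $\neq2$ is irreducible if it is not a finite sum $\sum u_iv_i$ of products of Killing fields of positive ranks; for rank 2 one also requires $f\neq cg$, $c$ constant. A field $h$ is potential if $h=dv$ for some smooth symmetric tensor field $v$ (a rank 0 potential field is the zero function). Global isothermal coordinates: $\mathbb T^2=\mathbb C/\Gamma$ for a lattice $\Gamma$, $g=e^{2\mu}(dx^2+dy^2)$ with $\mu$ smooth $\Gamma$-periodic, unique up to $z=az'+b$ for a fixed orientation. A pseudovector of weight $k$ assigns to each such coordinate system a pair $(X^1,X^2)$ with $X^1+iX^2=a^k(X'^1+iX'^2)$, $X^1-iX^2=\bar a^k(X'^1-iX'^2)$ under $z=az'$; constant if $X^1,X^2$ are constants, real if they are real. For $k\ge0$ and a constant pseudovector $c$ of weight $k+1$, $Z^{k,c}$ is the trace free symmetric rank $k$ tensor field with, in global isothermal coordinates,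 $Z^{k,c}_{1\dots1}=e^{2k\mu}(c^1\mu_x+c^2\mu_y)$, $Z^{k,c}_{1\dots12}=e^{2k\mu}(c^2\mu_x-c^1\mu_y)$, the other components being determined by trace freeness $Z_{1\dots1\,2\dots2}+Z_{1\dots1\,2\dots2\,22}=0$; for $k=0$, $Z^{0,c}=c^1\mu_x+c^2\mu_y$. *)

(* Defs.v *)
From HB Require Import structures.
From mathcomp Require Import all_boot all_order all_algebra.
From mathcomp Require Import all_classical all_reals all_analysis.
From mathcomp Require Import fingroup perm.
From mathcomp Require Import complex.

Set Implicit Arguments.
Unset Strict Implicit.
Unset Printing Implicit Defensive.

Import Order.TTheory GRing.Theory Num.Theory.
Import numFieldNormedType.Exports.
Local Open Scope ring_scope.
Local Open Scope complex_scope.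

(* A point of R^2 is given by its two coordinates x y; coordinate     *)
(* indices are 'I_2 (index 0 = x = "1", index 1 = y = "2").           *)

Section Calculus.
Variable R : realType.

Definition pd (k : 'I_2) (h : R -> R -> R) : R -> R -> R :=
  fun x y => if k == ord0 then derive1 (fun t => h t y) x
             else derive1 (fun t => h x t) y.

Definition iter_pd (ds : seq 'I_2) (h : R -> R -> R) : R -> R -> R :=
  foldr pd h ds.

Definition rsmooth (h : R -> R -> R) : Prop :=
  forall ds : seq 'I_2,
    continuous (fun p : R * R => iter_pd ds h p.1 p.2) /\
    (forall x y, derivable (fun t => iter_pd ds h t y) x 1 /\
                 derivable (fun t => iter_pd ds h x t) y 1).

Definition csmooth (f : R -> R -> R[i]) : Prop :=
  rsmooth (fun x y => complex.Re (f x y)) /\ rsmooth (fun x y => complex.Im (f x y)).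

Definition cpd (k : 'I_2) (f : R -> R -> R[i]) : R -> R -> R[i] :=
  fun x y => pd k (fun a b => complex.Re (f a b)) x y +i* pd k (fun a b => complex.Im (f a b)) x y.

Definition lattice_basis (w1 w2 : R * R) : Prop :=
  w1.1 * w2.2 - w1.2 * w2.1 != 0.

Definition lattice_periodic (T : Type) (w1 w2 : R * R) (h : R -> R -> T) : Prop :=
  forall x y, h (x + w1.1) (y + w1.2) = h x y /\ h (x + w2.1) (y + w2.2) = h x y.

Definition metric (mu : R -> R -> R) (i j : 'I_2) : R -> R -> R :=
  fun x y => if i == j then expR (2 * mu x y) else 0.

Definition metric_inv (mu : R -> R -> R) (i j : 'I_2) : R -> R -> R :=
  fun x y => if i == j then expR (- (2 * mu x y)) else 0.

Definition christoffel (mu : R -> R -> R) (l i j : 'I_2) : R -> R -> R :=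
  fun x y => 2^-1 * \sum_(k < 2) metric_inv mu l k x y *
     (pd i (metric mu k j) x y + pd j (metric mu i k) x y
      - pd k (metric mu i j) x y).

(* Complex-valued covariant tensor fields of rank k, given by their    *)
(* components T_{i_1 ... i_k}(x,y) in global isothermal coordinates.  *)

Definition tfield (k : nat) := ('I_k -> 'I_2) -> R -> R -> R[i].

Definition is_sym (k : nat) (T : tfield k) : Prop :=
  forall (s : 'S_k) (i : 'I_k -> 'I_2), T (fun a => i (s a)) = T i.

(* a smooth symmetric tensor field on the torus C/Gamma *)
Definition is_field (w1 w2 : R * R) (k : nat) (T : tfield k) : Prop :=
  is_sym T /\ (forall i, csmooth (T i)) /\ (forall i, lattice_periodic w1 w2 (T i)).

Definition is_real_field (k : nat) (T : tfield k) : Prop :=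
  forall i x y, complex.Im (T i x y) = 0.

Definition sym (k : nat) (T : tfield k) : tfield k :=
  fun i x y => (k`!%:R)^-1 * \sum_(s : 'S_k) T (fun a => i (s a)) x y.

Definition tprod (p q : nat) (f : tfield p) (h : tfield q) : tfield (p + q) :=
  sym (fun i x y => f (fun a => i (lshift q a)) x y *
                    h (fun b => i (rshift p b)) x y).

Definition tcast (a b : nat) (e : a = b) (T : tfield a) : tfield b :=
  fun i => T (fun j => i (cast_ord e j)).

Definition nabla (mu : R -> R -> R) (p : nat) (f : tfield p) : tfield p.+1 :=
  fun i x y =>
    cpd (i ord0) (f (fun a => i (lift ord0 a))) x y
    - \sum_(j < p) \sum_(l < 2)
        (christoffel mu l (i ord0) (i (lift ord0 j)) x y)%:C *
        f (fun a => if a == j then l else i (lift ord0 a)) x y.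

Definition dsym (mu : R -> R -> R) (p : nat) (f : tfield p) : tfield p.+1 :=
  sym (nabla mu f).

Definition gfield (mu : R -> R -> R) : tfield 2 :=
  fun i x y => (metric mu (i ord0) (i ord_max) x y)%:C.

Definition const_mul (k : nat) (c : R[i]) (T : tfield k) : tfield k :=
  fun i x y => c * T i x y.

Definition killing (w1 w2 : R * R) (mu : R -> R -> R) (k : nat)
  (f : tfield k) : Prop :=
  is_field w1 w2 f /\ dsym mu f = (fun _ _ _ => 0).

Definition decomposable (w1 w2 : R * R) (mu : R -> R -> R) (m : nat)
  (f : tfield m) : Prop :=
  exists (n : nat) (p q : 'I_n -> nat) (e : forall t, p t + q t = m)
         (u : forall t, tfield (p t)) (v : forall t, tfield (q t)),
    (forall t, 0 < p t)%N /\ (forall t, 0 < q t)%N /\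
    (forall t, killing w1 w2 mu (u t)) /\ (forall t, killing w1 w2 mu (v t)) /\
    f = (fun i x y => \sum_(t < n) tcast (e t) (tprod (u t) (v t)) i x y).

Definition irreducible_killing (w1 w2 : R * R) (mu : R -> R -> R) (m : nat)
  (f : tfield m) : Prop :=
  killing w1 w2 mu f /\ ~ decomposable w1 w2 mu f /\
  (forall (e : m = 2%N) (c : R[i]),
      tcast e f <> const_mul c (gfield mu)).

Definition potential (w1 w2 : R * R) (mu : R -> R -> R) (k : nat) :
  tfield k -> Prop :=
  match k with
  | 0%N => fun h => h = (fun _ _ _ => 0)
  | k'.+1 => fun h => exists v : tfield k', is_field w1 w2 v /\ h = dsym mu v
  end.

(* The field Z^{k,c}; c = (c1, c2) is a constant pseudovector of       *)
(* weight k+1, given by its components in the chosen coordinates.     *)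
(* With j the number of indices equal to 2, trace freeness            *)
(* Z_{..22} = - Z_{..11} gives                                        *)
(*   Z = e^{2k mu} (-1)^{j/2} (c1 mu_x + c2 mu_y)   for j even,        *)
(*   Z = e^{2k mu} (-1)^{(j-1)/2} (c2 mu_x - c1 mu_y) for j odd.       *)

Definition Zfield (mu : R -> R -> R) (k : nat) (c : R[i] * R[i]) : tfield k :=
  fun i x y =>
    let j := #|[set a | i a != ord0]| in
    let mx := (pd ord0 mu x y)%:C in
    let my := (pd ord_max mu x y)%:C in
    (expR (2 * k%:R * mu x y))%:C * (-1) ^+ (j./2) *
    (if odd j then c.2 * mx - c.1 * my else c.1 * mx + c.2 * my).

Definition real_pv (c : R[i] * R[i]) : Prop := complex.Im c.1 = 0 /\ complex.Im c.2 = 0.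

End Calculus.
Arguments Zfield {R} mu k c _ _ _.

(* Main.v *)
(* In the isothermal coordinate z the metric is e^{2 mu} dz dzbar, and a symmetric
   rank k tensor is a homogeneous polynomial; it is encoded here by the one-variable
   polynomial P(t) obtained by evaluating it on the vector (1, t). Then g becomes
   e^{2 mu} (1 + t^2), and d becomes an explicit first order operator under which g is
   parallel. At an isotropic direction, t = i or t = -i, the Killing equation says that
   e^{-2 m mu} P(t) satisfies a Cauchy-Riemann equation, so it is constant on the torus.
   A Killing tensor of rank m is therefore e^{2 m mu} (a dz^m + b dzbar^m) + g v with
   constants a, b, and since d (e^{2 m mu} (a dz^m + b dzbar^m)) = m g Z^{m-1,c} with
   c = (a + b, i (a - b)), it is Killing iff d v = - m Z^{m-1,c}. If a = b = 0 it is g v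
   with v Killing, hence reducible. Conversely, without irreducible Killing tensors of
   lower rank, all Killing tensors of lower rank, and all sums of their products, vanish
   at t = i and t = -i, which a tensor with (a, b) <> 0 does not. *)
Require Import Defs.
From HB Require Import structures.
From mathcomp Require Import all_boot all_order all_algebra.
From mathcomp Require Import all_classical all_reals all_analysis.
From mathcomp Require Import fingroup perm.
From mathcomp Require Import complex.
From mathcomp Require Import ring lra zify.

Set Implicit Arguments.
Unset Strict Implicit.
Unset Printing Implicit Defensive.

Import Order.TTheory GRing.Theory Num.Theory.
Import numFieldNormedType.Exports.
Local Open Scope ring_scope.

(** * Smooth functions of two real variables *)

Section RealCalculus.
Variable R : realType.
Implicit Types (f g h : R -> R -> R) (k : 'I_2).

Lemma ordinal2P k : k = ord0 \/ k = ord_max.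
Proof. by case: k => [[|[|//]] i]; [left|right]; apply: val_inj. Qed.

(** Joint continuity together with existence of both partials; continuity of the partials enters at
    the next level of [Cn]. *)
Definition C1 h : Prop :=
  continuous (fun p : R * R => h p.1 p.2) /\
  (forall x y, derivable (fun t => h t y) x 1 /\ derivable (fun t => h x t) y 1).

(** The recursion strips the derivative applied first, the last letter of the word in [rsmooth], so
    that closure under products and exponentials follows by induction on [n] from the Leibniz and
    chain rules. *)
Fixpoint Cn (n : nat) h : Prop :=
  C1 h /\ if n is n'.+1 then forall k, Cn n' (pd k h) else True.

Lemma rsmoothP h : rsmooth h <-> forall n, Cn n h.
Proof.
split=> [sh n|Ch].
  elim: n h sh => [|n IH] h sh; first by split=> //; exact: (sh [::]).
  split; first exact: (sh [::]).
  by move=> k; apply: IH => ds; have := sh (rcons ds k); rewrite /iter_pd foldr_rcons.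
move=> ds; elim/last_ind: ds h Ch => [|ds k IH] h Ch.
  by have [] := Ch 0%N.
rewrite /iter_pd foldr_rcons; apply: IH => n.
by have [_] := Ch n.+1; apply.
Qed.

Lemma CnW n h : Cn n.+1 h -> Cn n h.
Proof.
elim: n h => [|n IH] h [c1 s]; first by [].
by split=> // k; apply: IH; exact: s.
Qed.

Lemma rsmooth_C1 h : rsmooth h -> C1 h.
Proof. by move=> /(_ [::]). Qed.

Lemma rsmooth_pd k h : rsmooth h -> rsmooth (pd k h).
Proof. by move=> sh ds; have := sh (rcons ds k); rewrite /iter_pd foldr_rcons. Qed.

(** * Differentiation rules and closure properties of smooth functions *)

Lemma pd_cst (c : R) k : pd k (fun _ _ => c) = (fun _ _ => 0).
Proof. by apply/funext => x; apply/funext => y; rewrite /pd !derive1_cst; case: ifP. Qed.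

Lemma derive1D_fun (f g : R -> R) x : derivable f x 1 -> derivable g x 1 ->
  derive1 (fun t => f t + g t) x = derive1 f x + derive1 g x.
Proof. by move=> df dg; rewrite !derive1E; exact: (deriveD df dg). Qed.

Lemma derive1M_fun (f g : R -> R) x : derivable f x 1 -> derivable g x 1 ->
  derive1 (fun t => f t * g t) x = derive1 f x * g x + f x * derive1 g x.
Proof.
move=> df dg; rewrite !derive1E; have := deriveM df dg => ->.
by rewrite addrC /GRing.scale /= [X in X + _]mulrC.
Qed.

Lemma derivable_expR_comp (f : R -> R) x : derivable f x 1 ->
  derivable (fun t => expR (f t)) x 1.
Proof.
move=> df; have df' := derivableP df; have de := is_derive_expR (f x).
by have [] := is_derive1_comp de df'.
Qed.

Lemma derive1_expR_comp (f : R -> R) x : derivable f x 1 ->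
  derive1 (fun t => expR (f t)) x = expR (f x) * derive1 f x.
Proof.
move=> df; have := derive1_comp df (@derivable_expR R (f x)).
by rewrite (derive1E expR) derive_val => <-.
Qed.

Lemma pdD f g k : C1 f -> C1 g ->
  pd k (fun x y => f x y + g x y) = fun x y => pd k f x y + pd k g x y.
Proof.
move=> [_ df] [_ dg]; apply/funext => x; apply/funext => y; rewrite /pd.
have [df0 df1] := df x y; have [dg0 dg1] := dg x y.
by case: ifP => _; [exact: (derive1D_fun df0 dg0)|exact: (derive1D_fun df1 dg1)].
Qed.

Lemma pdM f g k : C1 f -> C1 g ->
  pd k (fun x y => f x y * g x y)
  = fun x y => pd k f x y * g x y + f x y * pd k g x y.
Proof.
move=> [_ df] [_ dg]; apply/funext => x; apply/funext => y; rewrite /pd.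
have [df0 df1] := df x y; have [dg0 dg1] := dg x y.
by case: ifP => _; [exact: (derive1M_fun df0 dg0)|exact: (derive1M_fun df1 dg1)].
Qed.

Lemma pd_expR f k : C1 f ->
  pd k (fun x y => expR (f x y)) = fun x y => expR (f x y) * pd k f x y.
Proof.
move=> [_ df]; apply/funext => x; apply/funext => y; rewrite /pd.
have [df0 df1] := df x y.
by case: ifP => _; [exact: (derive1_expR_comp df0)|exact: (derive1_expR_comp df1)].
Qed.

Lemma C1_cst (c : R) : C1 (fun _ _ => c).
Proof. by split=> *; [exact: cvg_cst|split; exact: derivable_cst]. Qed.

Lemma C1D f g : C1 f -> C1 g -> C1 (fun x y => f x y + g x y).
Proof.
move=> [cf df] [cg dg]; split=> [p|x y]; first exact: (cvgD (cf p) (cg p)).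
have [df0 df1] := df x y; have [dg0 dg1] := dg x y.
by split; [exact: (derivableD df0 dg0)|exact: (derivableD df1 dg1)].
Qed.

Lemma C1M f g : C1 f -> C1 g -> C1 (fun x y => f x y * g x y).
Proof.
move=> [cf df] [cg dg]; split=> [p|x y]; first exact: (cvgM (cf p) (cg p)).
have [df0 df1] := df x y; have [dg0 dg1] := dg x y.
by split; [exact: (derivableM df0 dg0)|exact: (derivableM df1 dg1)].
Qed.

Lemma C1_expR f : C1 f -> C1 (fun x y => expR (f x y)).
Proof.
move=> [cf df]; split=> [p|x y].
  by apply: (continuous_comp (cf p)); exact: continuous_expR.
have [df0 df1] := df x y.
by split; [exact: (derivable_expR_comp df0)|exact: (derivable_expR_comp df1)].
Qed.

Lemma Cn_cst n (c : R) : Cn n (fun _ _ => c).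
Proof.
elim: n c => [|n IH] c; first by split=> //; exact: C1_cst.
by split; [exact: C1_cst|move=> k; rewrite pd_cst].
Qed.

Lemma Cn_C1 n h : Cn n h -> C1 h.
Proof. by case: n => [|n] []. Qed.

Lemma CnD n f g : Cn n f -> Cn n g -> Cn n (fun x y => f x y + g x y).
Proof.
elim: n f g => [|n IH] f g Cf Cg; have cf := Cn_C1 Cf; have cg := Cn_C1 Cg.
  exact: (conj (C1D cf cg) I).
split; first exact: C1D.
by move=> k; rewrite pdD//; apply: IH; [case: Cf|case: Cg] => _; apply.
Qed.

Lemma CnM n f g : Cn n f -> Cn n g -> Cn n (fun x y => f x y * g x y).
Proof.
elim: n f g => [|n IH] f g Cf Cg; have cf := Cn_C1 Cf; have cg := Cn_C1 Cg.
  exact: (conj (C1M cf cg) I).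
split; first exact: C1M.
move=> k; rewrite pdM//; apply: CnD; apply: IH.
- by case: Cf => _; apply.
- exact: CnW.
- exact: CnW.
- by case: Cg => _; apply.
Qed.

Lemma Cn_expR n f : Cn n f -> Cn n (fun x y => expR (f x y)).
Proof.
elim: n => [|n IH] Cf; have cf := Cn_C1 Cf.
  exact: (conj (C1_expR cf) I).
split; first exact: C1_expR.
move=> k; rewrite pd_expR//; apply: CnM; first by apply: IH; exact: CnW.
by case: Cf => _; apply.
Qed.

Lemma rsmooth_cst (c : R) : rsmooth (fun _ _ => c).
Proof. by apply/rsmoothP => n; exact: Cn_cst. Qed.

Lemma rsmoothD f g : rsmooth f -> rsmooth g -> rsmooth (fun x y => f x y + g x y).
Proof. by move=> /rsmoothP sf /rsmoothP sg; apply/rsmoothP => n; exact: CnD. Qed.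

Lemma rsmoothM f g : rsmooth f -> rsmooth g -> rsmooth (fun x y => f x y * g x y).
Proof. by move=> /rsmoothP sf /rsmoothP sg; apply/rsmoothP => n; exact: CnM. Qed.

Lemma rsmooth_expR f : rsmooth f -> rsmooth (fun x y => expR (f x y)).
Proof. by move=> /rsmoothP sf; apply/rsmoothP => n; exact: Cn_expR. Qed.

Lemma rsmoothN f : rsmooth f -> rsmooth (fun x y => - f x y).
Proof.
move=> sf; have := rsmoothM (rsmooth_cst (-1)) sf.
by under eq_fun do under eq_fun do rewrite mulN1r.
Qed.

Lemma C1N f : C1 f -> C1 (fun x y => - f x y).
Proof.
move=> cf; have := C1M (C1_cst (-1)) cf.
by under eq_fun do under eq_fun do rewrite mulN1r.
Qed.

Lemma pdN f k : C1 f -> pd k (fun x y => - f x y) = fun x y => - pd k f x y.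
Proof.
move=> cf; have := pdM k (C1_cst (-1)) cf; rewrite pd_cst.
under eq_fun do under eq_fun do rewrite mulN1r.
move=> ->; apply/funext => x; apply/funext => y; ring.
Qed.


Lemma pdZ (c : R) f k : C1 f ->
  pd k (fun x y => c * f x y) = fun x y => c * pd k f x y.
Proof.
move=> cf; rewrite (pdM k (C1_cst c) cf) pd_cst.
by under eq_fun do under eq_fun do rewrite mul0r add0r.
Qed.

End RealCalculus.

(** * Doubly periodic harmonic functions are constant *)

Section Liouville.
Local Open Scope classical_set_scope.
Variable R : realType.
Implicit Types (f g h : R -> R -> R) (k : 'I_2).

(** * Mean value arguments and symmetry of second derivatives *)

Lemma mean_value (f : R -> R) a b : a < b -> (forall x, derivable f x 1) ->
  exists2 c, a < c < b & f b - f a = derive1 f c * (b - a).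
Proof.
move=> ab df.
have H x : x \in `]a, b[%R -> is_derive x 1 f (derive1 f x).
  by move=> _; rewrite derive1E; exact/derivableP.
have [|c] := MVT ab H.
  by apply: derivable_within_continuous => x _; exact: df.
by rewrite in_itv /= => ? ?; exists c.
Qed.

Lemma derivable_gt_right (f : R -> R) c : derivable f c 1 -> 0 < derive1 f c ->
  exists2 e, 0 < e & forall t, c < t < c + e -> f c < f t.
Proof.
move=> df; rewrite derive1E => fpos.
have /cvgr_gt/(_ _ fpos) : h^-1 *: (f (h *: 1 + c) - f c) @[h --> 0^'] --> 'D_1 f c.
  exact: df.
move=> [e /= e0 He]; exists e => // t /andP[ct te].
have := He (t - c); rewrite /= sub0r normrN gtr0_norm ?subr_gt0// ltrBlDl.
move=> /(_ te); rewrite gt_eqF ?subr_gt0// => /(_ isT).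
rewrite /GRing.scale /= mulr1 subrK pmulr_rgt0 ?invr_gt0 ?subr_gt0//.
Qed.

(** Otherwise [f'], which vanishes at the maximum [c], is positive just to the right of [c], and the
    mean value theorem gives a larger value of [f] there. *)
Lemma second_derivative_max (f : R -> R) c :
  (forall t, derivable f t 1) -> (forall t, derivable (derive1 f) t 1) ->
  (forall t, f t <= f c) -> derive1 (derive1 f) c <= 0.
Proof.
move=> df ddf fc; rewrite leNgt; apply/negP => /(derivable_gt_right (ddf c))[e e0 He].
have f'c : derive1 f c = 0.
  have c11 : c \in `]c - 1, c + 1[%R by rewrite in_itv /=; apply/andP; split; lra.
  have c2 : c - 1 <= c + 1 by lra.
  rewrite derive1E.
  by have [] := @derive1_at_max R f _ _ c c2 (fun t _ => df t) c11 (fun t _ => fc t).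
have [|d cd fE] := @mean_value f c (c + e / 2) _ df; first by lra.
have f'd : 0 < derive1 f d by rewrite -f'c; apply: He; lra.
have := fc (c + e / 2); rewrite -subr_le0 fE.
by rewrite leNgt => /negP; apply; apply: mulr_gt0 => //; lra.
Qed.

(** Mean value theorem twice: in [x] for the difference of [h] between the two heights, then in [y]
    for [pd ord0 h]. The second difference on the left is symmetric in the two variables, which is
    what [pdC] exploits. *)
Lemma rectangle_mean_value h x y s : 0 < s ->
  (forall x y, derivable (h^~ y) x 1) ->
  (forall x y, derivable (pd ord0 h x) y 1) ->
  exists a b, [/\ x < a < x + s, y < b < y + s &
    h (x + s) (y + s) - h (x + s) y - (h x (y + s) - h x y)
    = pd ord_max (pd ord0 h) a b * s ^+ 2].
Proof.
move=> s0 dh ddh.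
have dphi t : derivable (fun t => h t (y + s) - h t y) t 1 by exact: derivableB.
have [|a xa E] := @mean_value _ x (x + s) _ dphi; first by lra.
have [|b yb E2] := @mean_value (pd ord0 h a) y (y + s) _ (ddh a); first by lra.
exists a, b; split=> //; rewrite E.
have -> : derive1 (fun t => h t (y + s) - h t y) a
    = pd ord0 h a (y + s) - pd ord0 h a y.
  by rewrite /pd /= !derive1E; have := deriveB (dh a (y + s)) (dh a y).
by rewrite E2 /pd /=; ring.
Qed.

Lemma pd0E h x y : pd ord0 h x y = derive1 (h^~ y) x.
Proof. by rewrite /pd eqxx. Qed.

Lemma pd1E h x y : pd ord_max h x y = derive1 (h x) y.
Proof. by []. Qed.

Lemma pd_swap h :
  ((pd ord0 (fun x y => h y x) = fun x y => pd ord_max h y x) *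
  (pd ord_max (fun x y => h y x) = fun x y => pd ord0 h y x))%type.
Proof.
by split; apply/funext => x; apply/funext => y; rewrite pd0E pd1E.
Qed.

(** If the mixed derivatives [F] and [G] differed at [p], each would stay within half the gap of its
    value at [p] on a small square; but the second difference over that square, divided by its area,
    is both a value of [F] and a value of [G]. *)
Lemma pdC h : rsmooth h -> pd ord_max (pd ord0 h) = pd ord0 (pd ord_max h).
Proof.
move=> sh.
pose F (p : R * R) := pd ord_max (pd ord0 h) p.1 p.2.
pose G (p : R * R) := pd ord0 (pd ord_max h) p.1 p.2.
have cF : continuous F by case: (rsmooth_C1 (rsmooth_pd ord_max (rsmooth_pd ord0 sh))).
have cG : continuous G by case: (rsmooth_C1 (rsmooth_pd ord0 (rsmooth_pd ord_max sh))).
suff FG p : F p = G p.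
  by apply/funext => x; apply/funext => y; exact: (FG (x, y)).
apply/eqP; rewrite -subr_eq0; apply/negPn/negP => FGp.
have d0 : 0 < `|F p - G p| / 2 by rewrite divr_gt0 ?normr_gt0.
have /nbhs_ballP[e /= e0 He] : \forall q \near p,
    `|F p - F q| < `|F p - G p| / 2 /\ `|G p - G q| < `|F p - G p| / 2.
  have /cvgrPdist_lt/(_ _ d0) F1 := cF p; have /cvgrPdist_lt/(_ _ d0) G1 := cG p.
  exact: filterI F1 G1.
have s0 : 0 < e / 2 by rewrite divr_gt0.
have ball_in a b : p.1 < a < p.1 + e / 2 -> p.2 < b < p.2 + e / 2 -> ball p e (a, b).
  move=> /andP[? ?] /andP[? ?].
  by split; rewrite /= /ball /= distrC ger0_norm; lra.
have [_ dh] := rsmooth_C1 sh.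
have [_ d0h] := rsmooth_C1 (rsmooth_pd ord0 sh).
have [_ d1h] := rsmooth_C1 (rsmooth_pd ord_max sh).
have [a [b [ap bp E1]]] := @rectangle_mean_value h p.1 p.2 _ s0
  (fun x y => (dh x y).1) (fun x y => (d0h x y).2).
have [b' [a' [b'p a'p E2]]] := @rectangle_mean_value (fun x y => h y x) p.2 p.1 _ s0
  (fun x y => (dh y x).2) (fun x y => (d1h y x).1).
(* Exchanging the variables only reorders the four terms of the second difference. *)
have FGE : F (a, b) = G (a', b').
  have s2 : (e / 2) ^+ 2 != 0 by rewrite expf_neq0 ?gt_eqF.
  have swap (x y z t : R) : x - y - (z - t) = x - z - (y - t) by ring.
  rewrite (pd_swap h).1 (pd_swap (pd ord_max h)).2 in E2; rewrite /F /G /=.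
  move: E1 E2; move: (pd ord_max _ a b) (pd ord0 _ a' b') => z z' E1 E2.
  by apply: (mulIf s2); rewrite -E1 -E2 swap.
have [/= H1 _] := He _ (ball_in _ _ ap bp).
have [/= _ H2] := He _ (ball_in _ _ a'p b'p).
suff : `|F p - G p| < `|F p - G p| by rewrite ltxx.
rewrite [X in _ < X]splitr; apply: le_lt_trans (ltrD H1 H2).
rewrite FGE; move: (F p) (G p) (G (a', b')) => z1 z2 z3.
have -> : z1 - z2 = (z1 - z3) - (z2 - z3) by ring.
exact: ler_normB.
Qed.


(** In coordinates with respect to the lattice basis every point is congruent to one of the compact
    unit square. *)
Lemma lattice_periodic_max (w1 w2 : R * R) h : lattice_basis w1 w2 ->
  lattice_periodic w1 w2 h -> continuous (fun p : R * R => h p.1 p.2) ->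
  exists p : R * R, forall x y, h x y <= h p.1 p.2.
Proof.
rewrite /lattice_basis; set det := _ - _ => det0 ph ch.
pose P (p : R * R) : R * R := (p.1 * w1.1 + p.2 * w2.1, p.1 * w1.2 + p.2 * w2.2).
have cP : continuous P.
  have c a b : continuous (fun p : R * R => p.1 * a + p.2 * b).
    by move=> p; exact: (cvgD (cvgM cvg_fst (cvg_cst a)) (cvgM cvg_snd (cvg_cst b))).
  by move=> p; exact: (cvg_pair (c w1.1 w2.1 p) (c w1.2 w2.2 p)).
have shift_nat (n : nat) (s t : R) :
    (h (P (s + n%:R, t)).1 (P (s + n%:R, t)).2 = h (P (s, t)).1 (P (s, t)).2) /\
    (h (P (s, t + n%:R)).1 (P (s, t + n%:R)).2 = h (P (s, t)).1 (P (s, t)).2).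
  elim: n => [|n [IH1 IH2]]; first by rewrite !addr0.
  split; [rewrite -IH1|rewrite -IH2]; rewrite /P /=.
    have [<- _] := ph ((s + n%:R) * w1.1 + t * w2.1) ((s + n%:R) * w1.2 + t * w2.2).
    by rewrite -natr1; congr h; ring.
  have [_ <-] := ph (s * w1.1 + (t + n%:R) * w2.1) (s * w1.2 + (t + n%:R) * w2.2).
  by rewrite -natr1; congr h; ring.
have shift_int (n m : int) (s t : R) :
    h (P (s + n%:~R, t + m%:~R)).1 (P (s + n%:~R, t + m%:~R)).2
    = h (P (s, t)).1 (P (s, t)).2.
  transitivity (h (P (s, t + m%:~R)).1 (P (s, t + m%:~R)).2).
    case: n => n; first by have [] := shift_nat n s (t + m%:~R).
    have [+ _] := shift_nat n.+1 (s + (Negz n)%:~R) (t + m%:~R).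
    by rewrite NegzE mulrNz subrK => ->.
  case: m => m; first by have [] := shift_nat m s t.
  have [_ +] := shift_nat m.+1 s (t + (Negz m)%:~R).
  by rewrite NegzE mulrNz subrK => ->.
have cpt : compact (`[0, 1]%classic `*` `[0, 1]%classic : set (R * R)).
  by apply: compact_setX; exact: segment_compact.
have [||p _ pmax] := @compact_EVT_max _ R (fun p => h (P p).1 (P p).2) _ _ cpt.
- by exists (0, 0); split; rewrite /= in_itv /= lexx ler01.
- apply: continuous_subspaceT => p; exact: (continuous_comp (cP p) (ch (P p))).
exists (P p) => x y.
(* Cramer's rule gives the coordinates of [(x, y)] in the lattice basis; their integral parts are
   then removed. *)
pose s := (x * w2.2 - y * w2.1) / det; pose t := (w1.1 * y - w1.2 * x) / det.
have xyE : (x, y) = P (s, t) by rewrite /P /s /t /det; congr pair => /=; field.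
have -> : h x y = h (P (s, t)).1 (P (s, t)).2 by rewrite -xyE.
rewrite -[s](subrK (Num.floor s)%:~R) -[t](subrK (Num.floor t)%:~R) shift_int.
apply: (pmax (s - (Num.floor s)%:~R, t - (Num.floor t)%:~R)); apply: mem_set; split; rewrite /= in_itv /=; apply/andP; split.
- by rewrite subr_ge0 floor_le.
- by rewrite lerBlDr addrC ltW// -[X in _ + X](mulr1z 1) -intrD floorD1_gt.
- by rewrite subr_ge0 floor_le.
- by rewrite lerBlDr addrC ltW// -[X in _ + X](mulr1z 1) -intrD floorD1_gt.
Qed.

Lemma lattice_periodic_pd (w1 w2 : R * R) h k :
  lattice_periodic w1 w2 h -> lattice_periodic w1 w2 (pd k h).
Proof.
move=> ph x y.
have shift (a b : R) : (forall x y, h (x + a) (y + b) = h x y) ->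
    pd k h (x + a) (y + b) = pd k h x y.
  move=> hab; rewrite /pd; case: ifP => _; rewrite /derive1;
    apply: (congr1 (fun g : R -> R => lim (g t @[t --> 0^']))); apply/funext => t.
    by rewrite addrA !hab.
  by rewrite addrA !hab.
by split; apply: shift => a b; case: (ph a b).
Qed.

(** * The Laplacian and the maximum principle *)

Definition laplacian h : R -> R -> R :=
  fun x y => pd ord0 (pd ord0 h) x y + pd ord_max (pd ord_max h) x y.

Lemma laplacian_max h (p : R * R) : rsmooth h ->
  (forall x y, h x y <= h p.1 p.2) -> laplacian h p.1 p.2 <= 0.
Proof.
move=> sh hp; have [_ dh] := rsmooth_C1 sh.
have [_ d0h] := rsmooth_C1 (rsmooth_pd ord0 sh).
have [_ d1h] := rsmooth_C1 (rsmooth_pd ord_max sh).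
rewrite -[leRHS]addr0; apply: lerD.
  exact: (@second_derivative_max (h^~ p.2) p.1
    (fun t => (dh t p.2).1) (fun t => (d0h t p.2).1)).
exact: (@second_derivative_max (h p.1) p.2
  (fun t => (dh p.1 t).2) (fun t => (d1h p.1 t).2)).
Qed.

Lemma pd0_cst h : rsmooth h -> pd ord0 h = (fun _ _ => 0) ->
  pd ord_max h = (fun _ _ => 0) -> forall x y, h x y = h 0 0.
Proof.
move=> sh h0 h1 x y; have [_ dh] := rsmooth_C1 sh.
transitivity (h 0 y).
  apply: (@is_derive_0_is_cst R (h^~ y)) => t.
  apply: (DeriveDef (dh t y).1).
  by rewrite -derive1E; exact: (congr1 (fun g => g t y) h0).
apply: (@is_derive_0_is_cst R (h 0)) => t.
apply: (DeriveDef (dh 0 t).2).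
by rewrite -derive1E; exact: (congr1 (fun g => g 0 t) h1).
Qed.

Local Opaque pd.

Lemma laplacianD f g x y : rsmooth f -> rsmooth g ->
  laplacian (fun x y => f x y + g x y) x y = laplacian f x y + laplacian g x y.
Proof.
move=> sf sg; rewrite /laplacian.
rewrite !(pdD _ (rsmooth_C1 sf) (rsmooth_C1 sg)).
rewrite (pdD ord0 (rsmooth_C1 (rsmooth_pd ord0 sf)) (rsmooth_C1 (rsmooth_pd ord0 sg))).
rewrite (pdD ord_max (rsmooth_C1 (rsmooth_pd ord_max sf))
  (rsmooth_C1 (rsmooth_pd ord_max sg))).
exact: addrACA.
Qed.

Lemma laplacianZ (c : R) f x y : rsmooth f ->
  laplacian (fun x y => c * f x y) x y = c * laplacian f x y.
Proof.
move=> sf; rewrite /laplacian !(pdZ _ _ (rsmooth_C1 sf)).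
rewrite (pdZ _ _ (rsmooth_C1 (rsmooth_pd ord0 sf))).
by rewrite (pdZ _ _ (rsmooth_C1 (rsmooth_pd ord_max sf))) mulrDr.
Qed.

(** For harmonic [f] the last term drops and the Laplacian of the square is twice the squared
    gradient; this makes [u^2 + d |grad u|^2] subharmonic below. *)
Lemma laplacian_sqr f x y : rsmooth f ->
  laplacian (fun x y => f x y * f x y) x y =
  2 * (pd ord0 f x y ^+ 2 + pd ord_max f x y ^+ 2) + 2 * (f x y * laplacian f x y).
Proof.
move=> sf; have cf := rsmooth_C1 sf.
have ck k : C1 (pd k f) by exact/rsmooth_C1/rsmooth_pd.
have pd2 k : pd k (pd k (fun x y => f x y * f x y)) x y =
    2 * pd k f x y ^+ 2 + 2 * (f x y * pd k (pd k f) x y).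
  rewrite (pdM k cf cf) (pdD k (C1M (ck k) cf) (C1M cf (ck k))).
  by rewrite (pdM k (ck k) cf) (pdM k cf (ck k)) /=; ring.
rewrite {1}/laplacian (pd2 ord0) (pd2 ord_max) /laplacian.
move: (pd ord0 (pd ord0 f) x y) (pd ord_max (pd ord_max f) x y) => d e.
move: (f x y) (pd ord0 f x y) (pd ord_max f x y) => a b c; ring.
Qed.

(* For d > 0, u^2 + d |grad u|^2 has nonnegative Laplacian, which at a maximum
   forces grad u = 0; hence d |grad u|^2 <= max u^2 everywhere, for every d. *)
Lemma harmonic_lattice_periodic_cst (w1 w2 : R * R) u : lattice_basis w1 w2 ->
  lattice_periodic w1 w2 u -> rsmooth u -> (forall x y, laplacian u x y = 0) ->
  forall x y, u x y = u 0 0.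
Proof.
move=> basis pu su hu.
pose p := pd ord0 u; pose q := pd ord_max u.
have sp : rsmooth p by exact: rsmooth_pd.
have sq : rsmooth q by exact: rsmooth_pd.
have lap0 : laplacian u = fun _ _ => 0 by apply/funext => x; apply/funext => y.
(* Partial derivatives of a harmonic function are harmonic: differentiate the Laplace equation and
   commute derivatives. *)
have dlap0 k x y : pd k (pd ord0 p) x y + pd k (pd ord_max q) x y = 0.
  have <- : pd k (laplacian u) x y = 0 by rewrite lap0 pd_cst.
  by rewrite (pdD k (rsmooth_C1 (rsmooth_pd ord0 sp)) (rsmooth_C1 (rsmooth_pd ord_max sq))).
have hp x y : laplacian p x y = 0.
  by rewrite -(dlap0 ord0 x y) /laplacian /p (pdC su) (pdC sq).
have hq x y : laplacian q x y = 0.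
  by rewrite -(dlap0 ord_max x y) /laplacian /q -(pdC su) -(pdC sp).
have ssqr f : rsmooth f -> rsmooth (fun x y => f x y * f x y).
  by move=> sf; exact: rsmoothM.
pose G x y := p x y * p x y + q x y * q x y.
have sG : rsmooth G := rsmoothD (ssqr _ sp) (ssqr _ sq).
pose H (d : R) x y := u x y * u x y + d * G x y.
have sdG (d : R) : rsmooth (fun x y => d * G x y).
  exact: rsmoothM (rsmooth_cst d) sG.
have sH d : rsmooth (H d) := rsmoothD (ssqr _ su) (sdG d).
have pH d : lattice_periodic w1 w2 (H d).
  move=> x y; have [u1 u2] := pu x y.
  have [p1 p2] := lattice_periodic_pd ord0 pu x y.
  have [q1 q2] := lattice_periodic_pd ord_max pu x y.
  by rewrite /H /G /p /q u1 u2 p1 p2 q1 q2.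
have Hle (d : R) : 0 < d -> exists a : R * R, forall x y, H d x y <= u a.1 a.2 ^+ 2.
  move=> d0; have [a amax] := lattice_periodic_max basis (pH d) (rsmooth_C1 (sH d)).1.
  exists a => x y; apply: le_trans (amax _ _) _.
  have := laplacian_max (sH d) amax.
  rewrite (laplacianD _ _ (ssqr _ su) (sdG d)) (laplacianZ _ _ _ sG).
  rewrite (laplacianD _ _ (ssqr _ sp) (ssqr _ sq)) !laplacian_sqr; try assumption.
  rewrite hu hp hq /H /G -/p -/q.
  move: (pd ord0 p a.1 a.2) (pd ord_max p a.1 a.2) (pd ord0 q a.1 a.2)
    (pd ord_max q a.1 a.2) => A B C D.
  move: (p a.1 a.2) (q a.1 a.2) (u a.1 a.2) => P Q U; rewrite !mulr0 !addr0 => le0.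
  have : 0 <= d * (2 * (A ^+ 2 + B ^+ 2) + 2 * (C ^+ 2 + D ^+ 2)).
    by rewrite mulr_ge0 ?(ltW d0)// addr_ge0// mulr_ge0// addr_ge0// sqr_ge0.
  move: le0; set X := d * _ => le0 X0; have := sqr_ge0 P; have := sqr_ge0 Q => Q0 P0.
  have P2 : P ^+ 2 = 0 by apply: le_anti; apply/andP; split; lra.
  have Q2 : Q ^+ 2 = 0 by apply: le_anti; apply/andP; split; lra.
  by rewrite -!expr2 P2 Q2 addr0 mulr0 addr0.
(* [H 0] is [u^2], so its maximum [M] bounds every [u a.1 a.2 ^+ 2] produced by [Hle]. *)
have [b bmax] := lattice_periodic_max basis (pH 0) (rsmooth_C1 (sH 0)).1.
have G0 x y : G x y = 0.
  apply: le_anti; apply/andP; split; last by rewrite /G addr_ge0// -expr2 sqr_ge0.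
  rewrite leNgt; apply/negP => Gpos.
  set M := H 0 b.1 b.2 in bmax.
  have M0 : 0 <= M by rewrite /M /H mul0r addr0 -expr2 sqr_ge0.
  (* With this value of [d] the term [d * G x y] is [M + 1], which already exceeds the bound. *)
  have d0 : 0 < (M + 1) / G x y by rewrite divr_gt0// ltr_wpDl.
  have [a Ha] := Hle _ d0.
  have := Ha x y; rewrite /H divfK ?gt_eqF// leNgt => /negP; apply.
  have := bmax a.1 a.2; rewrite {1}/H mul0r addr0 -expr2 => aM.
  by apply: le_lt_trans aM _; have := sqr_ge0 (u x y); rewrite expr2; lra.
apply: (pd0_cst su); apply/funext => x; apply/funext => y;
  have := G0 x y; rewrite /G /p /q; move: (pd ord0 u x y) (pd ord_max u x y) => P Q;
  by rewrite -!expr2 => /eqP; rewrite paddr_eq0 ?sqr_ge0// !sqrf_eq0 => /andP[/eqP ? /eqP ?].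
Qed.

End Liouville.

(** * Complex-valued functions and the Cauchy-Riemann equations *)

Section ComplexCalculus.
Variable R : realType.
Local Notation C := R[i].
Implicit Types (F G : R -> R -> C) (k : 'I_2).
Local Open Scope complex_scope.

Local Opaque pd.

Lemma complex_eqP (z w : C) : complex.Re z = complex.Re w ->
  complex.Im z = complex.Im w -> z = w.
Proof. by case: z w => [a b] [c d] /= -> ->. Qed.

Lemma complex_ReM (z w : C) :
  complex.Re (z * w) = complex.Re z * complex.Re w - complex.Im z * complex.Im w.
Proof. by case: z w => [a b] [c d]. Qed.

Lemma complex_ImM (z w : C) :
  complex.Im (z * w) = complex.Re z * complex.Im w + complex.Im z * complex.Re w.
Proof. by case: z w => [a b] [c d]. Qed.

Lemma complex_ReD (z w : C) : complex.Re (z + w) = complex.Re z + complex.Re w.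
Proof. by case: z w => [a b] [c d]. Qed.

Lemma complex_ImD (z w : C) : complex.Im (z + w) = complex.Im z + complex.Im w.
Proof. by case: z w => [a b] [c d]. Qed.

Lemma csmooth_cst (c : C) : csmooth (fun _ _ => c).
Proof. by split; exact: rsmooth_cst. Qed.

Lemma csmooth_real (h : R -> R -> R) : rsmooth h -> csmooth (fun x y => (h x y)%:C).
Proof. by move=> sh; exact: (conj sh (rsmooth_cst 0)). Qed.

Lemma csmoothD F G : csmooth F -> csmooth G -> csmooth (fun x y => F x y + G x y).
Proof.
move=> [F1 F2] [G1 G2]; split.
  have := rsmoothD F1 G1; congr rsmooth; apply/funext => x; apply/funext => y.
  by rewrite complex_ReD.
have := rsmoothD F2 G2; congr rsmooth; apply/funext => x; apply/funext => y.
by rewrite complex_ImD.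
Qed.

Lemma csmoothM F G : csmooth F -> csmooth G -> csmooth (fun x y => F x y * G x y).
Proof.
move=> [F1 F2] [G1 G2]; split.
  have := rsmoothD (rsmoothM F1 G1) (rsmoothN (rsmoothM F2 G2)).
  congr rsmooth; apply/funext => x; apply/funext => y.
  by rewrite complex_ReM.
have := rsmoothD (rsmoothM F1 G2) (rsmoothM F2 G1).
congr rsmooth; apply/funext => x; apply/funext => y.
by rewrite complex_ImM.
Qed.

Lemma csmooth_sum (I : Type) (r : seq I) (P : pred I) (F : I -> R -> R -> C) :
  (forall i, csmooth (F i)) -> csmooth (fun x y => \sum_(i <- r | P i) F i x y).
Proof.
move=> sF; elim: r => [|i r IH].
  by have := csmooth_cst 0; congr csmooth; apply/funext => x; apply/funext => y; rewrite big_nil.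
case Pi: (P i).
  have := csmoothD (sF i) IH; congr csmooth; apply/funext => x; apply/funext => y.
  by rewrite big_cons Pi.
move: IH; congr csmooth; apply/funext => x; apply/funext => y.
by rewrite big_cons Pi.
Qed.

Lemma cpd_cst (c : C) k x y : cpd k (fun _ _ => c) x y = 0.
Proof. by rewrite /cpd !pd_cst. Qed.

Lemma cpd_real (h : R -> R -> R) k x y :
  cpd k (fun x y => (h x y)%:C) x y = (pd k h x y)%:C.
Proof. by rewrite /cpd /= pd_cst. Qed.

Lemma cpdD F G k x y : csmooth F -> csmooth G ->
  cpd k (fun x y => F x y + G x y) x y = cpd k F x y + cpd k G x y.
Proof.
move=> [/rsmooth_C1 F1 /rsmooth_C1 F2] [/rsmooth_C1 G1 /rsmooth_C1 G2].
rewrite /cpd; under [in pd k _]eq_fun do under eq_fun do rewrite complex_ReD.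
under [in X in _ +i* pd k X _ _ = _]eq_fun do under eq_fun do rewrite complex_ImD.
by rewrite (pdD k F1 G1) (pdD k F2 G2).
Qed.

Lemma cpdM F G k x y : csmooth F -> csmooth G ->
  cpd k (fun x y => F x y * G x y) x y
  = cpd k F x y * G x y + F x y * cpd k G x y.
Proof.
move=> [/rsmooth_C1 F1 /rsmooth_C1 F2] [/rsmooth_C1 G1 /rsmooth_C1 G2].
rewrite {1}/cpd.
under [in pd k _]eq_fun do under eq_fun do rewrite complex_ReM.
under [in X in _ +i* pd k X _ _ = _]eq_fun do under eq_fun do rewrite complex_ImM.
rewrite (pdD k (C1M F1 G1) (C1N (C1M F2 G2))) (pdN k (C1M F2 G2)).
rewrite (pdD k (C1M F1 G2) (C1M F2 G1)).
rewrite (pdM k F1 G1) (pdM k F2 G2) (pdM k F1 G2) (pdM k F2 G1) /cpd /=.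
move: (pd k _ x y) (pd k _ x y) => a b.
move: (pd k _ x y) (pd k _ x y) => c d.
case: (F x y) (G x y) => [u v] [w z] /=.
by apply: complex_eqP => /=; ring.
Qed.

Lemma cpd_sum (I : Type) (r : seq I) (P : pred I) (F : I -> R -> R -> C) k x y :
  (forall i, csmooth (F i)) ->
  cpd k (fun x y => \sum_(i <- r | P i) F i x y) x y
  = \sum_(i <- r | P i) cpd k (F i) x y.
Proof.
move=> sF; elim: r => [|i r IH].
  rewrite big_nil -[RHS](cpd_cst 0 k x y); congr (cpd k _ x y).
  by apply/funext => a; apply/funext => b; rewrite big_nil.
rewrite big_cons -IH; case Pi: (P i).
  rewrite -cpdD//; last exact: csmooth_sum.
  congr (cpd k _ x y); apply/funext => a; apply/funext => b.
  by rewrite big_cons Pi.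
by congr (cpd k _ x y); apply/funext => a; apply/funext => b; rewrite big_cons Pi.
Qed.

Lemma cpd0_cst F : csmooth F -> (forall k x y, cpd k F x y = 0) ->
  forall x y, F x y = F 0 0.
Proof.
move=> [F1 F2] dF x y; apply: complex_eqP.
  apply: (pd0_cst F1); apply/funext => a; apply/funext => b.
    by have := dF ord0 a b; case.
  by have := dF ord_max a b; case.
apply: (pd0_cst F2); apply/funext => a; apply/funext => b.
  by have := dF ord0 a b; case.
by have := dF ord_max a b; case.
Qed.

(** The real and imaginary parts are harmonic and periodic, hence constant. The sign [e] treats
    holomorphic ([e = 1]) and antiholomorphic ([e = -1]) functions together. *)
Lemma cauchy_riemann_lattice_periodic_cst (w1 w2 : R * R) F (e : R) :
  lattice_basis w1 w2 -> lattice_periodic w1 w2 F -> csmooth F -> e ^+ 2 = 1 ->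
  (forall x y, cpd ord0 F x y + (0 +i* e) * cpd ord_max F x y = 0) ->
  forall x y, F x y = F 0 0.
Proof.
move=> basis pF [su sv] e1 CR x y.
set u := fun x y => complex.Re (F x y) in su.
set v := fun x y => complex.Im (F x y) in sv.
have cv k : C1 (pd k v) by exact: rsmooth_C1 (rsmooth_pd k sv).
have cu k : C1 (pd k u) by exact: rsmooth_C1 (rsmooth_pd k su).
have CRe a b : pd ord0 u a b - e * pd ord_max v a b = 0 /\
               pd ord0 v a b + e * pd ord_max u a b = 0.
  have := CR a b; rewrite /cpd -/u -/v.
  move: (pd _ _ _ _) (pd _ _ _ _) (pd _ _ _ _) (pd _ _ _ _) => p q r s.
  by case=> E1 E2; split; [rewrite -[RHS]E1|rewrite -[RHS]E2]; ring.
have ux : pd ord0 u = fun a b => e * pd ord_max v a b.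
  apply/funext => a; apply/funext => b; have [+ _] := CRe a b.
  by move=> /eqP; rewrite subr_eq0 => /eqP.
have vx : pd ord0 v = fun a b => - e * pd ord_max u a b.
  apply/funext => a; apply/funext => b; have [_ +] := CRe a b.
  by move=> /eqP; rewrite addr_eq0 mulNr => /eqP.
have ee (z : R) : z = e * (e * z) by rewrite mulrA -expr2 e1 mul1r.
have uy : pd ord_max u = fun a b => - e * pd ord0 v a b.
  by apply/funext => a; apply/funext => b; rewrite vx /= !mulNr mulrN opprK -ee.
have vy : pd ord_max v = fun a b => e * pd ord0 u a b.
  by apply/funext => a; apply/funext => b; rewrite ux /= -ee.
have lu a b : laplacian u a b = 0.
  rewrite /laplacian ux uy !pdZ// (pdC sv).
  by move: (pd _ _ _ _) => z; ring.
have lv a b : laplacian v a b = 0.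
  rewrite /laplacian vx vy !pdZ// (pdC su).
  by move: (pd _ _ _ _) => z; ring.
have pu : lattice_periodic w1 w2 u by move=> a b; have [p q] := pF a b; rewrite /u p q.
have pv : lattice_periodic w1 w2 v by move=> a b; have [p q] := pF a b; rewrite /v p q.
apply: complex_eqP.
  exact: (harmonic_lattice_periodic_cst basis pu su lu).
exact: (harmonic_lattice_periodic_cst basis pv sv lv).
Qed.

End ComplexCalculus.

(** * Symmetric tensors as polynomials *)

Section TensorPolynomial.
Variable R : realType.
Local Notation C := R[i].
Local Notation index k := {ffun 'I_k -> 'I_2}.
Local Notation is_sym := Defs.is_sym.
Local Notation tcast := Defs.tcast.

(** Indices are read as 0 or 1, so this counts those equal to [ord_max]; a component of a symmetric
    tensor depends only on this number. *)
Definition weight k (i : 'I_k -> 'I_2) : nat := \sum_a i a.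

(* The value of T on (1, t, ..., 1, t), as a polynomial in t: the restriction of
   the homogeneous polynomial of T to the affine line {(1, t)}. *)
Definition pol k (T : tfield R k) (x y : R) : {poly C} :=
  \sum_(i : index k) T i x y *: 'X^(weight i).

Lemma weight_perm k (i : 'I_k -> 'I_2) (s : 'S_k) :
  weight (fun a => i (s a)) = weight i.
Proof. by rewrite /weight [RHS](reindex_inj (@perm_inj _ s)). Qed.

Lemma weight_le k (i : 'I_k -> 'I_2) : (weight i <= k)%N.
Proof.
rewrite /weight -[X in (_ <= X)%N]card_ord -sum1_card; apply: leq_sum => a _.
by rewrite -ltnS ltn_ord.
Qed.

(** Permuting a multi-index preserves its weight, so all [k!] summands have the same polynomial.
    Products and [dsym] can thus be computed before averaging. *)
Lemma pol_sym k (T : tfield R k) x y : pol (sym T) x y = pol T x y.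
Proof.
rewrite /pol /sym.
under eq_bigr do rewrite -scalerA scaler_suml.
rewrite -scaler_sumr exchange_big /=.
have E (s : 'S_k) : \sum_(i : index k) T (fun a => i (s a)) x y *: 'X^(weight i) =
    pol T x y.
  rewrite /pol [RHS](reindex (fun i : index k => [ffun a => i (s a)])) /=.
    apply: eq_bigr => i _.
    have -> : ([ffun a => i (s a)] : _ -> _) = (fun a => i (s a)).
      by apply/funext => a; rewrite ffunE.
    by rewrite weight_perm.
  exists (fun i : index k => [ffun a => i ((s^-1)%g a)]) => i _;
    by apply/ffunP => a; rewrite !ffunE ?permK ?permKV.
under eq_bigr do rewrite E.
rewrite sumr_const card_Sn -[X in _ *: X]scaler_nat scalerA mulVf ?scale1r // pnatr_eq0 -lt0n fact_gt0.
Qed.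

Lemma is_sym_sym k (T : tfield R k) : is_sym (sym T).
Proof.
move=> s i; apply/funext => x; apply/funext => y; rewrite /sym; congr (_ * _).
rewrite [RHS](reindex_inj (mulIg s)) /=; apply: eq_bigr => r _.
by congr (T _ x y); apply/funext => a; rewrite permM.
Qed.

Lemma coef_pol k (T : tfield R k) x y j :
  (pol T x y)`_j = \sum_(i : index k | weight i == j) T i x y.
Proof.
rewrite /pol coef_sum [RHS]big_mkcond /=; apply: eq_bigr => i _.
by rewrite coefZ coefXn eq_sym; case: eqP => _; rewrite ?mulr1 ?mulr0.
Qed.

Lemma size_pol k (T : tfield R k) x y : (size (pol T x y) <= k.+1)%N.
Proof.
apply/leq_sizeP => j kj; rewrite coef_pol big1 // => i /eqP ij.
by have := weight_le i; rewrite ij leqNgt kj.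
Qed.

(** The weight fixes the number of occurrences of both index values, so the two index words are
    rearrangements of each other. *)
Lemma eq_weight_perm k (i j : 'I_k -> 'I_2) :
  weight i = weight j -> exists s : 'S_k, i = fun a => j (s a).
Proof.
move=> ij.
pose t (l : 'I_k -> 'I_2) := [tuple l a | a < k].
have wE (l : 'I_k -> 'I_2) : count_mem ord_max (t l) = weight l.
  rewrite /t /= count_map -sum1_count big_mkcond big_enum /weight /=.
  by apply: eq_bigr => a _; case: (ordinal2P (l a)) => ->.
have w0E (l : 'I_k -> 'I_2) : (count_mem ord0 (t l) + weight l)%N = k.
  rewrite -wE -[RHS](size_tuple (t l)) -(count_predC (pred1 ord0)).
  by congr addn; apply: eq_count => b /=; case: (ordinal2P b) => ->.
have : perm_eq (t i) (t j).
  apply/allP => b _; apply/eqP.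
  by have [->|->] := ordinal2P b; [have := w0E i; have := w0E j|rewrite !wE]; lia.
move=> /tuple_permP[s /val_inj E]; exists s; apply/funext => a.
by have := congr1 (fun t => tnth t a) E; rewrite !tnth_mktuple.
Qed.

Lemma is_sym_weight k (T : tfield R k) (i j : 'I_k -> 'I_2) :
  is_sym T -> weight i = weight j -> T i = T j.
Proof. by move=> sT /eq_weight_perm[s ->]; rewrite sT. Qed.

(** The binomial coefficient of [k] and [j]: how often a symmetric component is repeated in a
    coefficient of [pol]. *)
Definition weight_card k j : C := #|[pred i : index k | weight i == j]|%:R.

Lemma weight_card_neq0 k j : (j <= k)%N -> weight_card k j != 0.
Proof.
move=> jk; rewrite /weight_card pnatr_eq0 -lt0n; apply/card_gt0P.
exists [ffun a : 'I_k => if (a < j)%N then ord_max else ord0]; rewrite inE; apply/eqP.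
rewrite /weight (eq_bigr (fun a : 'I_k => if (a < j)%N then 1%N else 0%N)).
  by rewrite -big_mkcond (big_ord_narrow jk) sum1_card card_ord.
by move=> a _; rewrite ffunE; case: ifP.
Qed.

Lemma coef_pol_sym k (T : tfield R k) x y (i : 'I_k -> 'I_2) : is_sym T ->
  (pol T x y)`_(weight i) = weight_card k (weight i) * T i x y.
Proof.
move=> sT; rewrite coef_pol (eq_bigr (fun=> T i x y)).
  by rewrite sumr_const mulr_natl.
by move=> j /eqP/(is_sym_weight sT) ->.
Qed.

(** Each coefficient is a nonzero multiple of the component of that weight; identities of symmetric
    tensors are therefore checked on polynomials. *)
Lemma pol_inj k (S T : tfield R k) : is_sym S -> is_sym T ->
  (forall x y, pol S x y = pol T x y) -> S = T.
Proof.
move=> sS sT ST; apply/funext => i; apply/funext => x; apply/funext => y.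
apply: (mulfI (weight_card_neq0 (weight_le i))).
by rewrite -!coef_pol_sym// ST.
Qed.

(** The inverse of [pol] in degree at most [k]: a coefficient is shared equally among the
    multi-indices of its weight. *)
Definition tensor_of_pol k (P : R -> R -> {poly C}) : tfield R k :=
  fun i x y => (P x y)`_(weight i) / weight_card k (weight i).
Arguments tensor_of_pol k P _ _ _ : clear implicits.

Lemma is_sym_tensor_of_pol k P : is_sym (tensor_of_pol k P).
Proof. by move=> s i; rewrite /tensor_of_pol weight_perm. Qed.

Lemma tensor_of_polK k (P : R -> R -> {poly C}) x y : (size (P x y) <= k.+1)%N ->
  pol (tensor_of_pol k P) x y = P x y.
Proof.
move=> sP; apply/polyP => j; have [jk|kj] := leqP j k; last first.
  by rewrite !nth_default// (leq_trans _ kj)// size_pol.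
rewrite coef_pol (eq_bigr (fun=> (P x y)`_j / weight_card k j)).
  by rewrite sumr_const -mulr_natr divfK ?weight_card_neq0.
by move=> i /eqP <-.
Qed.

(** A multi-index of rank [p + q] is glued from one of rank [p] and one of rank [q], and weights add
    under gluing. *)
Lemma pol_tprod p q (f : tfield R p) (h : tfield R q) x y :
  pol (tprod f h) x y = pol f x y * pol h x y.
Proof.
rewrite /tprod pol_sym /pol mulr_suml.
under [RHS]eq_bigr do rewrite mulr_sumr.
rewrite pair_big /=.
pose glue (u : index p * index q) : index (p + q) :=
  [ffun a : 'I_(p + q) => match fintype.split a with inl b => u.1 b | inr b => u.2 b end].
rewrite (reindex glue) /=; last first.
  exists (fun i : index (p + q) => ([ffun b : 'I_p => i (lshift q b)], [ffun b : 'I_q => i (rshift p b)])).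
    case=> u v _; congr pair; apply/ffunP => b; rewrite !ffunE.
      by rewrite (fintype.unsplitK (inl b)).
    by rewrite (fintype.unsplitK (inr b)).
  move=> i _; apply/ffunP => a; rewrite ffunE.
  by case: fintype.splitP => b ab; rewrite ffunE; congr (i _); apply: val_inj.
apply: eq_bigr => -[u v] _ /=.
have El : (fun a => glue (u, v) (lshift q a)) = u.
  by apply/funext => a; rewrite ffunE (fintype.unsplitK (inl a)).
have Er : (fun a => glue (u, v) (rshift p a)) = v.
  by apply/funext => a; rewrite ffunE (fintype.unsplitK (inr a)).
have -> : weight (glue (u, v)) = (weight u + weight v)%N.
  rewrite /weight big_split_ord; congr addn; apply: eq_bigr => a _; congr nat_of_ord.
    exact: (congr1 (@^~ a) El).
  exact: (congr1 (@^~ a) Er).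
by rewrite El Er exprD -scalerAl -scalerAr scalerA.
Qed.

Lemma tfield_cast_id a (T : tfield R a) : tcast erefl T = T.
Proof.
apply/funext => i; rewrite /Defs.tcast; congr T.
by apply/funext => j; rewrite cast_ord_id.
Qed.

Lemma pol_tcast a b (e : a = b) (T : tfield R a) x y :
  pol (tcast e T) x y = pol T x y.
Proof. by case: b / e; rewrite tfield_cast_id. Qed.

End TensorPolynomial.
Arguments tensor_of_pol {R} k P _ _ _.

(** * The symmetrized covariant derivative *)

Section SymmetrizedDerivative.
Variables (R : realType) (mu : R -> R -> R).
Hypothesis smu : rsmooth mu.
Local Notation C := R[i].
Local Notation index k := {ffun 'I_k -> 'I_2}.
Local Open Scope complex_scope.

Local Opaque pd.

Definition tensor_pd (b : 'I_2) k (f : tfield R k) : tfield R k :=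
  fun i => cpd b (f i).

(** The metric is diagonal, so only [k = l] contributes, and the conformal factor cancels against
    its inverse. *)
Lemma christoffelE l i j x y : christoffel mu l i j x y =
  (l == j)%:R * pd i mu x y + (l == i)%:R * pd j mu x y - (i == j)%:R * pd l mu x y.
Proof.
have cmu : C1 (fun x y => 2 * mu x y) by exact: C1M (C1_cst 2) (rsmooth_C1 smu).
have pd_metric k a b : pd k (metric mu a b) x y =
    (a == b)%:R * (expR (2 * mu x y) * (2 * pd k mu x y)).
  rewrite /metric; case: (a == b); last by rewrite pd_cst mul0r.
  by rewrite (pd_expR k cmu) (pdZ 2 k (rsmooth_C1 smu)) mul1r.
rewrite /christoffel (bigD1 l) //= big1 ?addr0; last first.
  by move=> k kl; rewrite /metric_inv eq_sym (negbTE kl) mul0r.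
rewrite !pd_metric /metric_inv eqxx (eq_sym i l) expRN.
have : expR (2 * mu x y) != 0 by rewrite gt_eqF ?expR_gt0.
move: (expR _) (pd i mu x y) (pd j mu x y) (pd l mu x y) => E a b c E0.
by field.
Qed.

Lemma sum_ffun_cons k (F : 'I_2 -> index k -> {poly C}) (G : index k.+1 -> {poly C}) :
  (forall i : index k.+1, G i = F (i ord0) [ffun a => i (lift ord0 a)]) ->
  \sum_i G i = \sum_b \sum_i F b i.
Proof.
move=> GF; rewrite pair_big /=.
pose cons (u : 'I_2 * index k) : index k.+1 :=
  [ffun a : 'I_k.+1 => if unlift ord0 a is Some b then u.2 b else u.1].
rewrite (reindex cons) /=; last first.
  exists (fun i : index k.+1 => (i ord0, [ffun a : 'I_k => i (lift ord0 a)])).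
    case=> b i _; congr pair; first by rewrite ffunE unlift_none.
    by apply/ffunP => a; rewrite !ffunE liftK.
  move=> i _; apply/ffunP => a; rewrite ffunE.
  by case: unliftP => [b|] ->; rewrite ?ffunE.
apply: eq_bigr => -[b i] _; rewrite GF /=; congr F; first by rewrite ffunE unlift_none.
by apply/ffunP => a; rewrite !ffunE liftK.
Qed.

Lemma weight_cons k (i : 'I_k.+1 -> 'I_2) :
  weight i = (i ord0 + weight (fun a => i (lift ord0 a)))%N.
Proof. by rewrite /weight big_ord_recl. Qed.

Lemma sum_index2 (F : 'I_2 -> {poly C}) : \sum_b F b = F ord0 + F ord_max.
Proof.
by rewrite big_ord_recl big_ord1; congr (_ + F _); apply: val_inj.
Qed.

(* dsym in polynomial form: on the line (1, t) the Christoffel terms of the metric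
   e^{2 mu} |dz|^2 become 2 k (mu_x + t mu_y) P - (1 + t^2) <grad mu, grad P>,
   where Euler's identity expresses the derivative of P in the first variable. *)
Definition dpol (a b : C) (k : nat) (P0 P1 P : {poly C}) : {poly C} :=
  P0 + 'X * P1 - (2 * k%:R) * (a%:P + 'X * b%:P) * P
  + (1 + 'X^2) * (a%:P * (k%:R * P - 'X * P^`()) + b%:P * P^`()).

Lemma dpol_lin a b k (A B : C) (P0 P1 P Q0 Q1 Q : {poly C}) :
  dpol a b k (A%:P * P0 + B%:P * Q0) (A%:P * P1 + B%:P * Q1) (A%:P * P + B%:P * Q)
  = A%:P * dpol a b k P0 P1 P + B%:P * dpol a b k Q0 Q1 Q.
Proof.
rewrite /dpol derivD !derivM !derivC !mul0r !add0r.
move: a%:P b%:P A%:P B%:P P^`() Q^`() => {}a {}b {}A {}B P' Q'; ring.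
Qed.

(** The algebra behind [d(g v) = g dv]: with [e = e^(2 mu)], [a = mu_x], [b = mu_y], the arguments
    are the Leibniz expansions of the derivatives of [e (1 + t^2) P]. *)
Lemma dpol_metricM a b k (e : C) (P0 P1 P : {poly C}) :
  dpol a b k.+2
    ((e * (2 * a))%:P * ((1 + 'X^2) * P) + e%:P * ((1 + 'X^2) * P0))
    ((e * (2 * b))%:P * ((1 + 'X^2) * P) + e%:P * ((1 + 'X^2) * P1))
    (e%:P * ((1 + 'X^2) * P))
  = e%:P * ((1 + 'X^2) * dpol a b k P0 P1 P).
Proof.
rewrite /dpol !(derivM, derivD, derivC, derivXn, derivX) /= !polyCM !rmorph_nat.
move: a%:P b%:P e%:P P^`() => {}a {}b {}e P'.
have -> : k.+2%:R = k%:R + 2 :> {poly C} by rewrite -addn2 natrD.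
by ring.
Qed.

(** With [K = k + 1], the terms [2 K a S] and [2 K b S] from differentiating [e^(2 K mu)] cancel
    [2 K (a + t b) S] in [dpol]. This is why the exponent is [2 K mu]; what remains is a multiple of
    [1 + t^2]. *)
Lemma dpol_exp a b k (e z : C) : let S := e%:P * (1 + z%:P * 'X) ^+ k.+1 in
  dpol a b k.+1 ((2 * k.+1%:R * a)%:P * S) ((2 * k.+1%:R * b)%:P * S) S
  = k.+1%:R * (e%:P * ((1 + 'X^2) * ((a + z * b)%:P * (1 + z%:P * 'X) ^+ k))).
Proof.
have dS : ((1 + z%:P * 'X) ^+ k.+1)^`() = k.+1%:R * (z%:P * (1 + z%:P * 'X) ^+ k).
  rewrite deriv_exp /= derivD derivM !derivC derivX mul0r mulr1 !add0r.
  by rewrite mulr_natl.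
rewrite /dpol derivM derivC dS mul0r add0r exprS (polyCD a) !polyCM !rmorph_nat.
move: {dS} a%:P b%:P e%:P z%:P ((1 + _) ^+ k) k.+1%:R => {}a {}b {}e {}z S K.
by ring.
Qed.

(** Contracting both lower slots with [v = (1, t)] gives [2 dmu(v) v^s - |v|^2 mu_s]; the factor
    [t^c] carries the remaining slots. *)
Lemma christoffel_pol (s : 'I_2) c x y : let m l := (pd l mu x y)%:C in
  \sum_l \sum_b ((christoffel mu s b l x y)%:C)%:P * 'X^(b + (l + c))
  = 2 * ((m ord0)%:P + 'X * (m ord_max)%:P) * 'X^(s + c)
    - (1 + 'X^2) * (m s)%:P * 'X^c.
Proof.
move=> m; rewrite !sum_index2 !christoffelE !exprD /m.
move: (pd ord0 mu x y) (pd ord_max mu x y) => a b.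
case: (ordinal2P s) => ->; rewrite /= ?eqxx ?expr0 ?expr1.
  move: ('X^c) => Xc; ring.
move: ('X^c) => Xc; ring.
Qed.

Definition ffun_upd k (i : index k) (j : 'I_k) (l : 'I_2) : index k :=
  [ffun a => if a == j then l else i a].

Lemma weight_upd k (i : index k) j l :
  weight (ffun_upd i j l) = (l + \sum_(a | a != j) i a)%N.
Proof.
rewrite /weight (bigD1 j) //= ffunE eqxx; congr addn.
by apply: eq_bigr => a /negbTE aj; rewrite ffunE aj.
Qed.

Lemma ffun_upd_id k (i : index k) j : ffun_upd i j (i j) = i.
Proof. by apply/ffunP => a; rewrite ffunE; case: eqP => [->|]. Qed.

(** The map sending [(i, l)] to [(ffun_upd i j l, i j)] is an involution; it frees the multi-index
    of the tensor and moves the replaced entry to the Christoffel symbol. *)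
Lemma sum_upd k (j : 'I_k) (F : index k -> 'I_2 -> 'I_2 -> {poly C}) :
  \sum_i \sum_l F (ffun_upd i j l) (i j) l = \sum_i \sum_l F i l (i j).
Proof.
rewrite !pair_big /=.
rewrite (reindex (fun u : index k * 'I_2 => (ffun_upd u.1 j u.2, u.1 j))) /=.
  apply: eq_bigr => -[i l] _ /=; congr (F _ _ _); last by rewrite ffunE eqxx.
  by apply/ffunP => a; rewrite !ffunE; case: eqP => [->|].
exists (fun u : index k * 'I_2 => (ffun_upd u.1 j u.2, u.1 j)) => -[i l] _ /=;
  congr pair; rewrite ?ffunE ?eqxx//;
  by apply/ffunP => a; rewrite !ffunE; case: eqP => [->|].
Qed.

(** Of the [k] slots, [n = weight i] hold the index 2, and deleting one of these lowers the exponent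
    by one. The two brackets are thus the derivatives of the monomial in the first variable (by
    Euler) and in the second. *)
Lemma sum_weight_rest k (i : index k) (m : 'I_2 -> C) (L : {poly C}) :
  \sum_j (L * 'X^(weight i) - (1 + 'X^2) * (m (i j))%:P * 'X^(\sum_(a | a != j) i a))
  = k%:R * L * 'X^(weight i)
    - (1 + 'X^2) * ((m ord0)%:P * (k%:R * 'X^(weight i) - 'X * ((weight i)%:R * 'X^((weight i).-1)))
      + (m ord_max)%:P * ((weight i)%:R * 'X^((weight i).-1))).
Proof.
set n := weight i.
(* The entry [i j] serves as its own 0/1 indicator; where the predecessor of [n = 0] occurs, it is
   multiplied by zero. *)
have term j : (m (i j))%:P * 'X^(\sum_(a | a != j) i a) =
    (m ord0)%:P * ('X^n - 'X * ((i j)%:R * 'X^(n.-1))) + (m ord_max)%:P * ((i j)%:R * 'X^(n.-1)).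
  have : n = (i j + \sum_(a | a != j) i a)%N by rewrite /n /weight (bigD1 j).
  move: (\sum_(a | a != j) i a)%N => c.
  case: (ordinal2P (i j)) => -> /= ->; rewrite ?add0n ?add1n /=; first by ring.
  by rewrite exprS; ring.
under eq_bigr do rewrite -mulrA term.
rewrite sumrB sumr_const card_ord -mulr_sumr big_split -!mulr_sumr sumrB -mulr_sumr /=.
rewrite -!mulr_suml sumr_const card_ord -natr_sum -/(weight i) -/n.
by rewrite -(mulrA k%:R) !mulr_natl.
Qed.

(** The first index is split off as the differentiation slot. Each Christoffel term is reindexed in
    its slot and contracted by [christoffel_pol], and the slots are then added by
    [sum_weight_rest]. *)
Lemma pol_dsym k (f : tfield R k) x y :
  pol (dsym mu f) x y =
  dpol (pd ord0 mu x y)%:C (pd ord_max mu x y)%:C k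
    (pol (tensor_pd ord0 f) x y) (pol (tensor_pd ord_max f) x y) (pol f x y).
Proof.
pose m l := (pd l mu x y)%:C.
rewrite /dsym pol_sym {1}/pol.
pose F b (i : index k) : {poly C} := (cpd b (f i) x y)%:P * 'X^(b + weight i)
  - \sum_j \sum_l ((christoffel mu l b (i j) x y)%:C)%:P * (f (ffun_upd i j l) x y)%:P
    * 'X^(b + weight i).
rewrite (@sum_ffun_cons _ F); last first.
  move=> i; rewrite /F weight_cons /nabla.
  have tl : ([ffun a => i (lift ord0 a)] : index k) = (fun a => i (lift ord0 a)) :> (_ -> _).
    by apply/funext => a; rewrite ffunE.
  rewrite tl -mul_polyC rmorphB mulrBl rmorph_sum mulr_suml; congr (_ - _).
  apply: eq_bigr => j _; rewrite rmorph_sum mulr_suml; apply: eq_bigr => l _.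
  rewrite rmorphM; congr (_ * (f _ x y)%:P * _).
  by apply/funext => a; rewrite !ffunE.
rewrite /F; under eq_bigr do rewrite big_split sumrN /=.
rewrite big_split sumrN /=.
have E0 : \sum_b \sum_(i : index k) (cpd b (f i) x y)%:P * 'X^(b + weight i)
    = pol (tensor_pd ord0 f) x y + 'X * pol (tensor_pd ord_max f) x y.
  rewrite sum_index2 /pol mulr_sumr; congr (_ + _); apply: eq_bigr => i _.
    by rewrite mul_polyC.
  by rewrite exprD mul_polyC /= -scalerAr expr1.
rewrite E0.
have E1 : \sum_b \sum_(i : index k) \sum_j \sum_l ((christoffel mu l b (i j) x y)%:C)%:P
      * (f (ffun_upd i j l) x y)%:P * 'X^(b + weight i)
   = \sum_j \sum_(i : index k) (f i x y)%:P * (2 * ((m ord0)%:P + 'X * (m ord_max)%:P) * 'X^(weight i)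
    - (1 + 'X^2) * (m (i j))%:P * 'X^(\sum_(a | a != j) i a)).
  under eq_bigr do rewrite exchange_big /=.
  rewrite exchange_big /=; apply: eq_bigr => j _.
  rewrite exchange_big /=.
  pose G (i : index k) (s l : 'I_2) : {poly C} := (f i x y)%:P *
    \sum_b ((christoffel mu l b s x y)%:C)%:P * 'X^(b + (s + \sum_(a | a != j) i a)).
  transitivity (\sum_i \sum_l G (ffun_upd i j l) (i j) l).
    apply: eq_bigr => i _; rewrite exchange_big /=; apply: eq_bigr => l _.
    rewrite /G mulr_sumr; apply: eq_bigr => b _.
    rewrite mulrCA mulrA; congr (_ * 'X^_); congr addn.
    rewrite -{1}(ffun_upd_id i j) weight_upd; congr addn.
    by apply: eq_bigr => a /negbTE aj; rewrite ffunE aj.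
  rewrite sum_upd; apply: eq_bigr => i _.
  rewrite /G -mulr_sumr christoffel_pol; congr (_ * (_ * 'X^_ - _)).
  by rewrite -[in RHS](ffun_upd_id i j) weight_upd.
rewrite E1 exchange_big /= /dpol -!addrA; congr (_ + (_ + _)).
have dE : (pol f x y)^`() =
    \sum_(i : index k) (f i x y)%:P * ((weight i)%:R * 'X^((weight i).-1)).
  rewrite /pol raddf_sum /=; apply: eq_bigr => i _.
  by rewrite linearZ /= derivXn mul_polyC mulr_natl.
have PE : pol f x y = \sum_(i : index k) (f i x y)%:P * 'X^(weight i).
  by apply: eq_bigr => i _; rewrite mul_polyC.
rewrite dE PE -/(m ord0) -/(m ord_max).
under eq_bigr do rewrite -mulr_sumr sum_weight_rest.
move: {E1} (m ord0)%:P (m ord_max)%:P => a b.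
(* The three sums over multi-indices, for the Christoffel part, the polynomial and its derivative,
   are compared term by term. *)
apply: (big_rec3 (fun A P D : {poly C} =>
  - A = - (2 * k%:R * (a + 'X * b) * P) +
   (1 + 'X^2) * (a * (k%:R * P - 'X * D) + b * D))).
  by ring.
move=> i A P D _; move: (f i x y)%:P ('X^(weight i)) => c Xn.
move: ((weight i)%:R * _) k%:R => d K E.
have -> : A = - - A by rewrite opprK.
by rewrite E; ring.
Qed.

(** * Linearity of the operator and differentiation of coefficients *)

Definition tsmooth k (f : tfield R k) : Prop := forall i, csmooth (f i).

Definition tlin k (a b : C) (f h : tfield R k) : tfield R k :=
  fun i x y => a * f i x y + b * h i x y.

Lemma csmoothZ (a : C) F : csmooth F -> csmooth (fun x y => a * F x y).
Proof. exact: (csmoothM (csmooth_cst a)). Qed.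

Lemma cpdZ (a : C) F b x y : csmooth F ->
  cpd b (fun x y => a * F x y) x y = a * cpd b F x y.
Proof. by move=> sF; rewrite (cpdM b x y (csmooth_cst a) sF) cpd_cst mul0r add0r. Qed.

Lemma tsmooth_tlin k a b (f h : tfield R k) :
  tsmooth f -> tsmooth h -> tsmooth (tlin a b f h).
Proof. by move=> sf sh i; exact: (csmoothD (csmoothZ a (sf i)) (csmoothZ b (sh i))). Qed.

Lemma pol_tlin k a b (f h : tfield R k) x y :
  pol (tlin a b f h) x y = a%:P * pol f x y + b%:P * pol h x y.
Proof.
rewrite /pol !mulr_sumr -big_split /=; apply: eq_bigr => i _.
by rewrite /tlin scalerDl -!scalerA !mul_polyC.
Qed.

Lemma tensor_pd_tlin k a b (f h : tfield R k) c : tsmooth f -> tsmooth h ->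
  tensor_pd c (tlin a b f h) = tlin a b (tensor_pd c f) (tensor_pd c h).
Proof.
move=> sf sh; apply/funext => i; apply/funext => x; apply/funext => y.
rewrite /tensor_pd /tlin (cpdD c x y (csmoothZ a (sf i)) (csmoothZ b (sh i))).
by rewrite (cpdZ a c x y (sf i)) (cpdZ b c x y (sh i)).
Qed.

Lemma pol_dsym_tlin k a b (f h : tfield R k) x y : tsmooth f -> tsmooth h ->
  pol (dsym mu (tlin a b f h)) x y
  = a%:P * pol (dsym mu f) x y + b%:P * pol (dsym mu h) x y.
Proof.
move=> sf sh; rewrite !pol_dsym (tensor_pd_tlin _ _ _ sf sh).
by rewrite (tensor_pd_tlin _ _ _ sf sh) !pol_tlin dpol_lin.
Qed.

Lemma csmooth_coef_pol k (f : tfield R k) j : tsmooth f ->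
  csmooth (fun x y => (pol f x y)`_j).
Proof.
move=> sf; have := csmooth_sum (index_enum (index k)) (fun i => weight i == j) (fun i => sf i).
by congr csmooth; apply/funext => x; apply/funext => y; rewrite coef_pol.
Qed.

Lemma cpd_coef_pol b k (f : tfield R k) j x y : tsmooth f ->
  cpd b (fun x y => (pol f x y)`_j) x y = (pol (tensor_pd b f) x y)`_j.
Proof.
move=> sf; rewrite coef_pol.
rewrite -(cpd_sum (index_enum (index k)) (fun i => weight i == j) b x y (fun i => sf i)).
by congr (cpd b _ x y); apply/funext => a; apply/funext => c; rewrite coef_pol.
Qed.

Lemma horner_pol k (f : tfield R k) x y t :
  (pol f x y).[t] = \sum_(i : index k) t ^+ weight i * f i x y.
Proof.
by rewrite /pol horner_sum; apply: eq_bigr => i _; rewrite hornerZ hornerXn mulrC.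
Qed.

Lemma csmooth_horner_pol k (f : tfield R k) t : tsmooth f ->
  csmooth (fun x y => (pol f x y).[t]).
Proof.
move=> sf; have := csmooth_sum (index_enum (index k)) xpredT
  (fun i : index k => csmoothZ (t ^+ weight i) (sf i)).
by congr csmooth; apply/funext => x; apply/funext => y; rewrite horner_pol.
Qed.

Lemma cpd_horner_pol b k (f : tfield R k) t x y : tsmooth f ->
  cpd b (fun x y => (pol f x y).[t]) x y = (pol (tensor_pd b f) x y).[t].
Proof.
move=> sf; rewrite horner_pol; under [RHS]eq_bigr do rewrite -(cpdZ _ _ _ _ (sf _)).
rewrite -(cpd_sum (index_enum (index k)) xpredT b x y
  (fun i : index k => csmoothZ (t ^+ weight i) (sf i))).
by congr (cpd b _ x y); apply/funext => a; apply/funext => c; rewrite horner_pol.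
Qed.

(** Leibniz rule for the scalar factor [h]: [W] does not depend on the point, so differentiation
    passes through it coefficient by coefficient. *)
Lemma pol_tensor_pdM b j k (f : tfield R j) (v : tfield R k) h (W : {poly C}) :
  tsmooth f -> tsmooth v -> csmooth h ->
  (forall x y, pol f x y = (h x y)%:P * (W * pol v x y)) ->
  forall x y, pol (tensor_pd b f) x y =
    (cpd b h x y)%:P * (W * pol v x y) + (h x y)%:P * (W * pol (tensor_pd b v) x y).
Proof.
move=> sf sv sh fE x y; apply/polyP => n; rewrite -cpd_coef_pol// coefD !coefCM.
have sterm (l : 'I_n.+1) := csmoothZ W`_l (csmooth_coef_pol (n - l) sv).
have ssum := csmooth_sum (index_enum 'I_n.+1) xpredT sterm.
transitivity (cpd b (fun x y => h x y *
    \sum_(l < n.+1) (W`_l * (pol v x y)`_(n - l))) x y).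
  by congr (cpd b _ x y); apply/funext => a; apply/funext => c; rewrite fE coefCM coefM.
rewrite (cpdM b x y sh ssum) coefM; congr (_ * _ + _ * _).
rewrite (cpd_sum (index_enum 'I_n.+1) xpredT b x y sterm) coefM; apply: eq_bigr => l _.
by rewrite (cpdZ _ _ _ _ (csmooth_coef_pol (n - l) sv)) cpd_coef_pol.
Qed.

(** * Conformal factors, the metric and powers of [dz] *)

Lemma rsmooth_conformal (c : R) : rsmooth (fun x y => expR (c * mu x y)).
Proof. exact: rsmooth_expR (rsmoothM (rsmooth_cst c) smu). Qed.

Lemma pd_conformal (c : R) b x y :
  pd b (fun x y => expR (c * mu x y)) x y = expR (c * mu x y) * (c * pd b mu x y).
Proof.
have cmu := C1M (C1_cst c) (rsmooth_C1 smu).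
by rewrite (pd_expR b cmu) (pdZ c b (rsmooth_C1 smu)).
Qed.

Lemma cpd_conformal (c : R) b x y :
  cpd b (fun x y => (expR (c * mu x y))%:C) x y
  = (expR (c * mu x y))%:C * (c%:C * (pd b mu x y)%:C).
Proof. by rewrite cpd_real pd_conformal !rmorphM. Qed.

(* The metric, with polynomial e^{2 mu} (1 + t^2), is parallel: d(g v) = g dv. *)
Lemma pol_dsym_metricM k (f : tfield R k.+2) (v : tfield R k) :
  tsmooth f -> tsmooth v ->
  (forall x y, pol f x y = (expR (2 * mu x y))%:C%:P * ((1 + 'X^2) * pol v x y)) ->
  forall x y, pol (dsym mu f) x y =
    (expR (2 * mu x y))%:C%:P * ((1 + 'X^2) * pol (dsym mu v) x y).
Proof.
move=> sf sv fE x y; have se := csmooth_real (rsmooth_conformal 2).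
rewrite (pol_dsym f) (pol_dsym v) !(pol_tensor_pdM _ sf sv se fE) fE.
by rewrite !cpd_conformal rmorph_nat dpol_metricM.
Qed.

(* For z = 'i and z = - 'i these are e^{2 k mu} dz^k and its conjugate. *)
Definition power_tensor k (z : C) : tfield R k :=
  fun i x y => (expR (2 * k%:R * mu x y))%:C * z ^+ weight i.
Arguments power_tensor k z _ _ _ : clear implicits.

Lemma tsmooth_power_tensor k z : tsmooth (power_tensor k z).
Proof.
move=> i; apply: csmoothM; last exact: csmooth_cst.
exact: csmooth_real (rsmooth_conformal _).
Qed.

(** Distributivity: each of the [k] factors chooses [1] or [z t], and the choices form the
    multi-index. *)
Lemma sum_exp_weight k (z : C) :
  \sum_(i : index k) z ^+ weight i *: 'X^(weight i) = (1 + z%:P * 'X) ^+ k :> {poly C}.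
Proof.
transitivity (\prod_(a < k) \sum_(b : 'I_2) (z%:P * 'X : {poly C}) ^+ b).
  rewrite bigA_distr_bigA; apply: eq_bigr => i _.
  by rewrite prodrXr -/(weight i) exprMn -rmorphXn mul_polyC.
by under eq_bigr do rewrite sum_index2 expr0 expr1; rewrite prodr_const card_ord.
Qed.

Lemma pol_power_tensor k z x y : pol (power_tensor k z) x y =
  (expR (2 * k%:R * mu x y))%:C%:P * (1 + z%:P * 'X) ^+ k.
Proof.
rewrite -sum_exp_weight mulr_sumr; apply: eq_bigr => i _.
by rewrite -scalerA mul_polyC.
Qed.

Lemma tensor_pd_power_tensor b k z x y :
  pol (tensor_pd b (power_tensor k z)) x y =
  (2 * k%:R * (pd b mu x y)%:C)%:P * pol (power_tensor k z) x y.
Proof.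
rewrite /pol mulr_sumr; apply: eq_bigr => i _; rewrite mul_polyC scalerA; congr (_ *: _).
rewrite /tensor_pd /power_tensor.
rewrite (cpdM b x y (csmooth_real (rsmooth_conformal _)) (csmooth_cst _)).
rewrite cpd_cst mulr0 addr0 cpd_conformal rmorphM !rmorph_nat.
by rewrite mulrAC mulrC mulrA.
Qed.

Lemma pol_dsym_power_tensor k z x y :
  pol (dsym mu (power_tensor k.+1 z)) x y =
  k.+1%:R * ((expR (2 * k.+1%:R * mu x y))%:C%:P * ((1 + 'X^2) *
    (((pd ord0 mu x y)%:C + z * (pd ord_max mu x y)%:C)%:P * (1 + z%:P * 'X) ^+ k))).
Proof. by rewrite pol_dsym !tensor_pd_power_tensor pol_power_tensor dpol_exp. Qed.

End SymmetrizedDerivative.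
Arguments power_tensor {R} mu k z _ _ _.

(** * Killing tensors *)

Section KillingTensors.
Variables (R : realType) (w1 w2 : R * R) (mu : R -> R -> R).
Hypothesis basis : lattice_basis w1 w2.
Hypothesis smu : rsmooth mu.
Hypothesis pmu : lattice_periodic w1 w2 mu.
Local Notation C := R[i].
Local Notation index k := {ffun 'I_k -> 'I_2}.
Local Notation is_sym := Defs.is_sym.
Local Notation tcast := Defs.tcast.
Local Notation I := (Complex 0 1 : C).
Local Notation conf x y := (expR (2 * mu x y))%:C%C.
Local Notation is_field := (is_field w1 w2).
Local Notation killing := (killing w1 w2 mu).

Local Opaque pd.

Lemma II : I * I = -1.
Proof. by rewrite -expr2 sqr_i. Qed.

Lemma conf_neq0 (r : R) : (expR r)%:C%C != 0 :> C.
Proof. by rewrite fmorph_eq0 gt_eqF ?expR_gt0. Qed.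

Lemma field_sym k (f : tfield R k) : is_field f -> is_sym f.
Proof. by case. Qed.

Lemma field_tsmooth k (f : tfield R k) : is_field f -> tsmooth f.
Proof. by case=> _ []. Qed.

Lemma is_field_tlin k a b (f h : tfield R k) :
  is_field f -> is_field h -> is_field (tlin a b f h).
Proof.
move=> [sf [cf pf]] [sh [ch ph]]; split=> [s i|].
  by rewrite /tlin sf sh.
apply: (conj (tsmooth_tlin a b cf ch)).
move=> i x y; have [f1 f2] := pf i x y; have [h1 h2] := ph i x y.
by rewrite /tlin f1 f2 h1 h2.
Qed.

Lemma is_field_power_tensor k z : is_field (power_tensor mu k z).
Proof.
split=> [s i|]; first by rewrite /power_tensor weight_perm.
split; first exact: tsmooth_power_tensor.
by move=> i x y; have [m1 m2] := pmu x y; rewrite /power_tensor m1 m2.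
Qed.

Lemma lattice_periodic_pol k (f : tfield R k) : is_field f ->
  lattice_periodic w1 w2 (pol f).
Proof.
move=> [_ [_ pf]] x y; rewrite /pol; split; apply: eq_bigr => i _;
  by have [f1 f2] := pf i x y; rewrite ?f1 ?f2.
Qed.

Lemma is_field_tensor_of_pol k (P : R -> R -> {poly C}) :
  (forall j, csmooth (fun x y => (P x y)`_j)) -> lattice_periodic w1 w2 P ->
  is_field (tensor_of_pol k P).
Proof.
move=> sP pP; split; first exact: is_sym_tensor_of_pol.
split=> [i|i x y]; first by apply: csmoothM; [exact: sP|exact: csmooth_cst].
by have [p1 p2] := pP x y; rewrite /tensor_of_pol p1 p2.
Qed.

Definition tzero k : tfield R k := fun _ _ _ => 0.
Arguments tzero k _ _ _ : clear implicits.

Lemma is_sym0 k : is_sym (tzero k).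
Proof. by []. Qed.

Lemma pol0 k x y : pol (tzero k) x y = 0.
Proof. by rewrite /pol big1 // => i _; rewrite scale0r. Qed.

Lemma killingP k (f : tfield R k) :
  killing f <-> is_field f /\ forall x y, pol (dsym mu f) x y = 0.
Proof.
split=> -[ff df]; split=> //; first by move=> x y; rewrite df (pol0 k.+1).
apply: (@pol_inj _ _ _ (tzero k.+1)) => [||x y]; first exact: is_sym_sym.
  exact: is_sym0.
by rewrite df pol0.
Qed.

(** * Multiplication and division by the metric *)

Lemma size_1DX2 : size (1 + 'X^2 : {poly C}) = 3.
Proof. by rewrite addrC size_polyDl size_polyXn // size_poly1. Qed.

Lemma metricM_inj (x y : R) (A B : {poly C}) :
  (conf x y)%:P * ((1 + 'X^2) * A) = (conf x y)%:P * ((1 + 'X^2) * B) -> A = B.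
Proof.
have w0 : 1 + 'X^2 != 0 :> {poly C} by rewrite -size_poly_eq0 size_1DX2.
by move=> /(mulfI _) E; apply: (mulfI w0); apply: E; rewrite polyC_eq0 conf_neq0.
Qed.

(** The product of [g] and [v], where [e^(2 mu) (1 + t^2)] is the polynomial of [g]. *)
Definition metricM k (v : tfield R k) : tfield R k.+2 :=
  tensor_of_pol k.+2 (fun x y => (conf x y)%:P * ((1 + 'X^2) * pol v x y)).

Lemma pol_metricM k (v : tfield R k) x y :
  pol (metricM v) x y = (conf x y)%:P * ((1 + 'X^2) * pol v x y).
Proof.
rewrite tensor_of_polK// mul_polyC (leq_trans (size_scale_leq _ _))//.
by rewrite (leq_trans (size_polyMleq _ _))// size_1DX2 /= !ltnS size_pol.
Qed.

Lemma is_field_metricM k (v : tfield R k) : is_field v -> is_field (metricM v).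
Proof.
move=> fv; have sv := field_tsmooth fv; apply: is_field_tensor_of_pol => [j|x y].
  have sterm (l : 'I_j.+1) := csmoothZ (1 + 'X^2 : {poly C})`_l
    (csmooth_coef_pol (j - l) sv).
  have := csmoothM (csmooth_real (rsmooth_conformal smu 2))
    (csmooth_sum (index_enum 'I_j.+1) xpredT sterm).
  by congr csmooth; apply/funext => x; apply/funext => y; rewrite coefCM coefM.
have [m1 m2] := pmu x y; have [v1 v2] := lattice_periodic_pol fv x y.
by rewrite m1 m2 v1 v2.
Qed.

(** Vanishing on the complex isotropic vectors [(1, i)] and [(1, -i)] of [g], the condition for
    divisibility by [g]. *)
Definition isotropic_zero k (f : tfield R k) : Prop :=
  forall x y t, 1 + t ^+ 2 = 0 -> (pol f x y).[t] = 0.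

Lemma isotropicP (t : C) : 1 + t ^+ 2 = 0 -> t = I \/ t = - I.
Proof.
move=> t2; have : (t - I) * (t + I) = 0.
  have -> : (t - I) * (t + I) = t ^+ 2 - I * I by ring.
  by rewrite II opprK addrC.
by move=> /eqP; rewrite mulf_eq0 subr_eq0 addr_eq0 => /orP[/eqP|/eqP]; [left|right].
Qed.

Lemma isotropicI : 1 + I ^+ 2 = 0.
Proof. by rewrite expr2 II subrr. Qed.

Lemma isotropicNI : 1 + (- I) ^+ 2 = 0.
Proof. by rewrite sqrrN isotropicI. Qed.

Lemma factor_1DX2 : 1 + 'X^2 = ('X - I%:P) * ('X - (- I)%:P) :> {poly C}.
Proof.
have -> : ('X - I%:P) * ('X - (- I)%:P) = 'X^2 - I%:P * I%:P :> {poly C}.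
  by rewrite rmorphN; ring.
by rewrite -polyCM II rmorphN opprK addrC.
Qed.

Lemma isotropic_dvd k (f : tfield R k) x y : isotropic_zero f ->
  (1 + 'X^2) %| pol f x y.
Proof.
move=> f0; have := @uniq_roots_dvdp C (pol f x y) [:: I; - I].
rewrite !big_cons big_nil mulr1 -factor_1DX2; apply.
  by rewrite /= /root !f0 ?eqxx//; [exact: isotropicNI|exact: isotropicI].
rewrite uniq_rootsE /= inE andbT -subr_eq0 opprK.
by rewrite eq_complex /= negb_and orbC -mulr2n -natr1 natr1 pnatr_eq0.
Qed.

(** The polynomial has the roots [i] and [-i], so [1 + t^2] divides it at every point; what remains
    is smoothness and periodicity of the quotient. *)
Lemma metric_division k (f : tfield R k.+2) : is_field f -> isotropic_zero f ->
  exists2 v : tfield R k, is_field v &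
    forall x y, pol f x y = (conf x y)%:P * ((1 + 'X^2) * pol v x y).
Proof.
move=> ff f0; pose q x y := pol f x y %/ (1 + 'X^2).
have fq x y : pol f x y = (1 + 'X^2) * q x y.
  by rewrite mulrC divpK// isotropic_dvd.
(* The coefficients obey [q_j = p_j - q_(j-2)], so smoothness propagates by induction in steps of
   two. *)
have sq j : csmooth (fun x y => (q x y)`_j).
  have cf := csmooth_coef_pol j (field_tsmooth ff).
  elim/ltn_ind: j cf => -[|[|j]] IH cf.
  - move: cf; congr csmooth; apply/funext => x; apply/funext => y.
    by rewrite fq mulrDl mul1r coefD coefXnM addr0.
  - move: cf; congr csmooth; apply/funext => x; apply/funext => y.
    by rewrite fq mulrDl mul1r coefD coefXnM addr0.
  have jlt : (j < j.+2)%N by [].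
  have := csmoothD cf (csmoothZ (-1) (IH j jlt (csmooth_coef_pol j (field_tsmooth ff)))).
  congr csmooth; apply/funext => x; apply/funext => y.
  by rewrite fq mulrDl mul1r coefD coefXnM /= subSS subSS subn0 mulN1r addrK.
(* The factor [e^(-2 mu)] compensates the conformal factor of [g]. *)
pose Q x y : {poly C} := ((expR (- (2) * mu x y))%:C%C)%:P * q x y.
exists (tensor_of_pol k Q).
  apply: is_field_tensor_of_pol => [j|x y].
    have := csmoothM (csmooth_real (rsmooth_conformal smu (- (2)))) (sq j).
    by congr csmooth; apply/funext => x; apply/funext => y; rewrite coefCM.
  have [m1 m2] := pmu x y; have [f1 f2] := lattice_periodic_pol ff x y.
  by rewrite /Q /q m1 m2 f1 f2.
move=> x y; rewrite tensor_of_polK; last first.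
  rewrite /Q mul_polyC (leq_trans (size_scale_leq _ _))// size_divp; last first.
    by rewrite -size_poly_eq0 size_1DX2.
  by rewrite size_1DX2 leq_subLR; exact: size_pol.
have eE : conf x y * (expR (- (2) * mu x y))%:C%C = 1.
  by rewrite -rmorphM /= -expRD -mulrDl subrr mul0r expR0.
by rewrite fq /Q (mulrCA (1 + 'X^2)) [RHS]mulrA -polyCM eE mul1r.
Qed.

Lemma horner_dpol (a b : C) k (P0 P1 P : {poly C}) t : 1 + t ^+ 2 = 0 ->
  (dpol a b k P0 P1 P).[t]
  = P0.[t] + t * P1.[t] - 2 * k%:R * (a + t * b) * P.[t].
Proof.
move=> t2; have -> : dpol a b k P0 P1 P = P0 + 'X * P1 - (2 * k%:R)%:P * (a%:P + 'X * b%:P) * P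
    + (1 + 'X^2) * (a%:P * (k%:R * P - 'X * P^`()) + b%:P * P^`()).
  by rewrite polyCM !rmorph_nat.
by rewrite !hornerE t2 mul0r addr0.
Qed.

(** At [t = i e] the part of [dpol] with [1 + t^2] drops out. The integrating factor [e^(-2 k mu)]
    then absorbs the zeroth order term and leaves a Cauchy-Riemann equation. *)
Lemma isotropic_constant k (f : tfield R k) (e : R) : killing f -> e ^+ 2 = 1 ->
  exists c, forall x y,
    (pol f x y).[Complex 0 e] = (expR (2 * k%:R * mu x y))%:C%C * c.
Proof.
move=> /killingP[ff df] e1; set t := Complex 0 e.
have sf := field_tsmooth ff.
have t2 : 1 + t ^+ 2 = 0.
  by rewrite /t; apply: complex_eqP; rewrite /= -?expr2 ?e1; ring.
pose r x y := (expR (- (2 * k%:R) * mu x y))%:C%C * (pol f x y).[t].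
have sr := csmooth_real (rsmooth_conformal smu (- (2 * k%:R))).
have sh := csmooth_horner_pol t sf.
have rcst : forall x y, r x y = r 0 0.
  apply: (cauchy_riemann_lattice_periodic_cst basis _ _ e1).
  - move=> x y; have [m1 m2] := pmu x y; have [f1 f2] := lattice_periodic_pol ff x y.
    by rewrite /r m1 m2 f1 f2.
  - exact: (csmoothM sr sh).
  move=> x y; rewrite -/t !(cpdM _ x y sr sh) !(cpd_conformal smu) !cpd_horner_pol//.
  have alg (E p q a b P : C) : p + t * q - 2 * k%:R * (a + t * b) * P = 0 ->
      E * (- (2 * k%:R) * a) * P + E * p + t * (E * (- (2 * k%:R) * b) * P + E * q) = 0.
    by move=> H; rewrite -(mulr0 E) -H; ring.
  rewrite rmorphN rmorphM !rmorph_nat; apply: alg.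
  by rewrite -horner_dpol// -(pol_dsym smu) df horner0.
exists (r 0 0) => x y; rewrite -(rcst x y) /r mulrA -rmorphM -expRD -mulrDl subrr.
by rewrite mul0r expR0 mul1r.
Qed.

Lemma gfieldE i x y : gfield mu i x y = if weight i == 1%N then 0 else conf x y.
Proof.
have -> : weight i = (i ord0 + i ord_max)%N.
  by rewrite /weight big_ord_recl big_ord1; congr (_ + i _)%N; apply: val_inj.
rewrite /gfield /metric.
by case: (ordinal2P (i ord0)) => ->; case: (ordinal2P (i ord_max)) => ->.
Qed.

Lemma is_field_gfield : is_field (gfield mu).
Proof.
split=> [s i|].
  by apply/funext => x; apply/funext => y; rewrite !gfieldE weight_perm.
suff sg i : csmooth (gfield mu i).
  by split=> // i x y; have [m1 m2] := pmu x y; rewrite !gfieldE m1 m2.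
have -> : gfield mu i = fun x y => if weight i == 1%N then 0 else conf x y.
  by apply/funext => x; apply/funext => y; rewrite gfieldE.
case: (weight i == 1%N); first exact: csmooth_cst.
exact: csmooth_real (rsmooth_conformal smu 2).
Qed.

Lemma sum_index0 (F : index 0 -> {poly C}) i : \sum_j F j = F i.
Proof.
rewrite (eq_bigr (fun=> F i)); first by rewrite sumr_const card_ffun !card_ord expn0 mulr1n.
by move=> j _; congr F; apply/ffunP; case.
Qed.

Lemma pol_rank0 (f : tfield R 0) i x y : pol f x y = (f i x y)%:P.
Proof.
rewrite /pol (sum_index0 _ [ffun a => i a]) /weight big_ord0 expr0 alg_polyC.
by congr (f _ x y)%:P; apply/funext; case.
Qed.

Lemma pol_gfield x y : pol (gfield mu) x y = (conf x y)%:P * (1 + 'X^2).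
Proof.
pose m b c : C := if (b == c :> 'I_2) then conf x y else 0.
rewrite /pol (@sum_ffun_cons _ _ (fun b i => m b (i ord0) *: 'X^(b + i ord0))); last first.
  move=> i; rewrite weight_cons /weight big_ord1 ffunE /m; congr (_ *: _).
  rewrite /gfield /metric; have -> : lift ord0 ord0 = ord_max :> 'I_2 by apply: val_inj.
  by case: ifP.
transitivity (\sum_b \sum_c m b c *: 'X^(b + c) : {poly C}).
  apply: eq_bigr => b _; rewrite (@sum_ffun_cons _ _ (fun c _ => m b c *: 'X^(b + c))) //.
  apply: eq_bigr => c _.
  exact: (sum_index0 (fun=> m b c *: 'X^(b + c)) [ffun=> ord0]).
rewrite !sum_index2 /m /= !scale0r !mul_polyC scalerDr addr0 add0r.
by rewrite expr0.
Qed.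

Lemma dpol_rank0 (a b c : C) (P0 P1 : {poly C}) :
  dpol a b 0 P0 P1 c%:P = P0 + 'X * P1.
Proof. by rewrite /dpol derivC; ring. Qed.

(** [g] is [g] times the constant function 1, and [d(g v) = g dv]. *)
Lemma killing_gfield : killing (gfield mu).
Proof.
apply/killingP; split; first exact: is_field_gfield.
pose one : tfield R 0 := fun _ _ _ => 1.
have s1 : tsmooth one by move=> i; exact: csmooth_cst.
have i0 : 'I_0 -> 'I_2 by move=> _; exact: ord0.
move=> x y; rewrite (pol_dsym_metricM smu (field_tsmooth is_field_gfield) s1); last first.
  by move=> a b; rewrite pol_gfield (pol_rank0 _ i0) mulr1.
by rewrite (pol_dsym smu) !(pol_rank0 _ i0) /tensor_pd !cpd_cst dpol_rank0 polyC0 !mulr0 addr0 !mulr0.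
Qed.

(** * The fields [Zfield] and the leading part of a Killing tensor *)

Lemma weight_cardE k (i : 'I_k -> 'I_2) : #|[set a | i a != ord0]| = weight i.
Proof.
rewrite -sum1_card (eq_bigl (fun a => i a != ord0)); last by move=> a; rewrite inE.
rewrite big_mkcond; apply: eq_bigr => a _.
by case: (ordinal2P (i a)) => ->.
Qed.

Lemma exp_imaginary (z : C) n : z * z = -1 ->
  z ^+ n = (-1) ^+ n./2 * (if odd n then z else 1).
Proof.
move=> zz; rewrite -[in LHS](odd_double_half n) exprD -muln2 mulnC exprM expr2 zz mulrC.
by case: (odd n).
Qed.

(** In the parameters [a], [b] the trace free field splits into its [dz^k] and [dzbar^k] parts; the
    sign rule of [Zfield] is the pattern of powers of [i] and [-i]. *)
Lemma pol_Zfield k (a b : C) x y :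
  pol (Zfield mu k (a + b, I * (a - b))) x y =
  (expR (2 * k%:R * mu x y))%:C%C%:P *
  (a%:P * (((pd ord0 mu x y)%:C%C + I * (pd ord_max mu x y)%:C%C)%:P * (1 + I%:P * 'X) ^+ k)
   + b%:P * (((pd ord0 mu x y)%:C%C + - I * (pd ord_max mu x y)%:C%C)%:P
      * (1 + (- I)%:P * 'X) ^+ k)).
Proof.
rewrite -!sum_exp_weight /pol !mulr_sumr -big_split mulr_sumr /=; apply: eq_bigr => i _.
rewrite !mul_polyC !scalerA -scalerDl scalerA; congr (_ *: _).
rewrite /Zfield weight_cardE !(exp_imaginary (z := I)) ?II//.
rewrite (exp_imaginary (z := - I)) ?mulrNN ?II//=.
move: (pd _ _ _ _)%:C%C (pd _ _ _ _)%:C%C (expR _)%:C%C => p q e.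
case: (odd _); last by ring.
(* Inserting [- (I * I) = 1] makes both sides agree as polynomials in a formal [I]. *)
have -> : (a + b) * p = - (I * I) * (a + b) * p by rewrite II opprK mul1r.
by ring.
Qed.

(** [e^(2 k mu) (a dz^k + b dzbar^k)], the part of a Killing tensor seen modulo [g]. *)
Definition leading_tensor k (a b : C) : tfield R k :=
  tlin a b (power_tensor mu k I) (power_tensor mu k (- I)).
Arguments leading_tensor k a b _ _ _ : clear implicits.

Lemma is_field_leading_tensor k a b : is_field (leading_tensor k a b).
Proof. by apply: is_field_tlin; exact: is_field_power_tensor. Qed.

(** [dz] is 2 on [(1, -i)] and 0 on [(1, i)], and [dzbar] the other way round; so [a] is read off at
    [-i] and [b] at [i]. *)
Lemma horner_leading_tensor k a b x y : (0 < k)%N ->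
  (pol (leading_tensor k a b) x y).[- I] = (expR (2 * k%:R * mu x y))%:C%C * (2 ^+ k * a)
  /\ (pol (leading_tensor k a b) x y).[I] = (expR (2 * k%:R * mu x y))%:C%C * (2 ^+ k * b).
Proof.
move=> k0.
have hz (z t : C) : ((1 + z%:P * 'X) ^+ k).[t] = (1 + z * t) ^+ k.
  by rewrite horner_exp hornerD hornerM !hornerC hornerX.
have I1 : I * - I = 1 by rewrite mulrN II opprK.
have I2 : - I * I = 1 by rewrite mulNr II opprK.
have I3 : - I * - I = -1 by rewrite mulrNN II.
rewrite pol_tlin !pol_power_tensor !(hornerD, hornerM, hornerC) !hz I1 I2 I3 II.
rewrite subrr expr0n eqn0Ngt k0 /=.
by split; ring.
Qed.

(** The link between Killing tensors and [Zfield]: of the weight [e^(2 (k+1) mu)], one factor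
    [e^(2 mu)] goes with [1 + t^2] into [g] and the rest belongs to [Zfield]. *)
Lemma pol_dsym_leading_tensor k a b x y :
  pol (dsym mu (leading_tensor k.+1 a b)) x y =
  k.+1%:R * ((conf x y)%:P * ((1 + 'X^2) * pol (Zfield mu k (a + b, I * (a - b))) x y)).
Proof.
have sp := tsmooth_power_tensor smu.
apply: etrans (pol_dsym_tlin smu a b x y (sp k.+1 I) (sp k.+1 (- I))) _.
apply: etrans (congr2 (fun p q => a%:P * p + b%:P * q)
  (pol_dsym_power_tensor smu k I x y) (pol_dsym_power_tensor smu k (- I) x y)) _.
apply: etrans (esym (congr1 (fun p => k.+1%:R * ((conf x y)%:P * ((1 + 'X^2) * p)))
  (pol_Zfield k a b x y))).
have -> : expR (2 * k.+1%:R * mu x y) = expR (2 * mu x y) * expR (2 * k%:R * mu x y).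
  by rewrite -expRD; congr expR; rewrite -natr1; ring.
rewrite (rmorphM (real_complex R)) polyCM.
move: (expR _)%:C%C%:P (expR _)%:C%C%:P a%:P b%:P (_ + _)%:P (_ + _)%:P => e f A B p q.
move: ((1 + _) ^+ k) ((1 + _) ^+ k) k.+1%:R => S T K.
by ring.
Qed.

(** * Reducible Killing tensors and isotropic vanishing *)

Lemma horner_1DX2 (t : C) : 1 + t ^+ 2 = 0 -> (1 + 'X^2).[t] = 0.
Proof. by rewrite !hornerE. Qed.

Lemma isotropic_zero_metricM k (v : tfield R k) : isotropic_zero (metricM v).
Proof.
by move=> x y t t2; rewrite pol_metricM !hornerM (horner_1DX2 t2) mul0r mulr0.
Qed.

Lemma isotropic_zero_multiple_gfield k (f : tfield R k) (e : k = 2%N) (c : C) :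
  tcast e f = const_mul c (gfield mu) -> isotropic_zero f.
Proof.
move=> fE x y t t2; rewrite -(pol_tcast e) fE.
have -> : pol (const_mul c (gfield mu)) x y = c%:P * pol (gfield mu) x y.
  by rewrite /pol mulr_sumr; apply: eq_bigr => i _; rewrite mul_polyC scalerA.
by rewrite pol_gfield !hornerM (horner_1DX2 t2) !mulr0.
Qed.

(** Evaluation at a root of [1 + t^2] is multiplicative, and each factor of a product has rank
    strictly between 0 and [k], so the first one already vanishes there. *)
Lemma isotropic_zero_decomposable k (f : tfield R k) :
  (forall j (h : tfield R j), (0 < j < k)%N -> killing h -> isotropic_zero h) ->
  decomposable w1 w2 mu f -> isotropic_zero f.
Proof.
move=> IH [n [p [q [e [u [v [p0 [q0 [ku [kv ->]]]]]]]]]] x y t t2.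
have -> : pol (fun i x y => \sum_(s < n) tcast (e s) (tprod (u s) (v s)) i x y) x y
    = \sum_(s < n) pol (u s) x y * pol (v s) x y.
  under [RHS]eq_bigr do rewrite -pol_tprod -(pol_tcast (e _)) /pol.
  by rewrite exchange_big /=; apply: eq_bigr => i _; rewrite scaler_suml.
rewrite horner_sum big1 // => s _; rewrite hornerM (IH _ (u s)) ?mul0r//.
by have := e s; have := p0 s; have := q0 s; lia.
Qed.

(* The converse direction rests on this: without irreducible Killing tensors of
   lower rank, every Killing tensor is a multiple of a power of g. *)
Lemma isotropic_zero_killing m :
  (forall k (f : tfield R k), (1 <= k < m)%N -> ~ irreducible_killing w1 w2 mu f) ->
  forall k (f : tfield R k), (0 < k < m)%N -> killing f -> isotropic_zero f.
Proof.
move=> noirr; elim/ltn_ind => k IH f km kf.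
have [df|ndf] := pselect (decomposable w1 w2 mu f).
  apply: isotropic_zero_decomposable df => j h jk; apply: IH; lia.
have [[e [c fE]]|ncg] := pselect (exists (e : k = 2%N) c, tcast e f = const_mul c (gfield mu)).
  exact: isotropic_zero_multiple_gfield fE.
exfalso; apply: (noirr k f km); split=> //; split=> // e c fE.
by apply: ncg; exists e, c.
Qed.

(** A polynomial of degree at most one divisible by [1 + t^2] is zero. *)
Lemma tfield_rank1_eq0 (f : tfield R 1) : is_sym f -> isotropic_zero f -> f = tzero 1.
Proof.
move=> sf f0; apply: pol_inj => // x y.
have := isotropic_dvd x y f0; rewrite pol0 => dv.
apply/eqP; apply: contraTT dv => P0; apply: contraL (size_pol f x y) => dv.
by rewrite -ltnNge; have := dvdp_leq P0 dv; rewrite size_1DX2.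
Qed.

(** Division by [g] gives [f = g v] with [v] Killing. Rank 1 ([f = 0]), rank 2 ([v] a constant) and
    higher rank (a genuine product) are excluded by different clauses of irreducibility. *)
Lemma killing_isotropic_zero_reducible k (f : tfield R k.+1) :
  killing f -> isotropic_zero f -> ~ irreducible_killing w1 w2 mu f.
Proof.
move=> kf f0 [_ [ndf ncg]]; have [ff df] := (killingP f).1 kf.
case: k f kf f0 ndf ncg ff df => [|k] f kf f0 ndf ncg ff df.
  (* In rank 1 the tensor is zero, which is the empty sum of products. *)
  apply: ndf; exists 0%N, (fun=> 1%N), (fun=> 0%N).
  unshelve eexists; first by case.
  exists (fun=> tzero 1), (fun=> tzero 0); do 4 (split; first by case).
  rewrite (tfield_rank1_eq0 (field_sym ff) f0).
  by apply/funext => i; apply/funext => x; apply/funext => y; rewrite big_ord0.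
have [v fv fE] := metric_division ff f0.
have kv : killing v.
  apply/killingP; split=> // x y; apply: (@metricM_inj x y).
  rewrite -(pol_dsym_metricM smu (field_tsmooth ff) (field_tsmooth fv) fE) df.
  by rewrite !mulr0.
case: k f kf f0 ndf ncg ff df v fv fE kv => [|k] f kf f0 ndf ncg ff df v fv fE kv.
  (* In rank 2 the quotient is a function; its differential has the two partials as coefficients, so
     it is constant and [f] is a constant multiple of [g]. *)
  pose i0 (a : 'I_0) : 'I_2 := ord0.
  have vc : forall x y, v i0 x y = v i0 0 0.
    have [_ dv] := (killingP v).1 kv.
    apply: cpd0_cst; first exact: field_tsmooth fv i0.
    move=> b x y; have := dv x y.
    rewrite (pol_dsym smu) !(pol_rank0 _ i0) dpol_rank0 /tensor_pd => E.
    case: (ordinal2P b) => ->.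
      have := congr1 (fun p : {poly C} => p`_0) E.
      by rewrite /= coefD coefC mulrC coefMX addr0 coef0.
    have := congr1 (fun p : {poly C} => p`_1) E.
    by rewrite /= coefD coefC mulrC coefMX coefC add0r coef0.
  apply: (ncg erefl (v i0 0 0)); rewrite tfield_cast_id; apply: pol_inj.
  - exact: field_sym ff.
  - move=> s i; rewrite /const_mul.
    by rewrite (field_sym is_field_gfield).
  move=> x y; rewrite fE (pol_rank0 _ i0) vc.
  have -> : pol (const_mul (v i0 0 0) (gfield mu)) x y
      = (v i0 0 0)%:P * pol (gfield mu) x y.
    by rewrite /pol mulr_sumr; apply: eq_bigr => i _; rewrite mul_polyC scalerA.
  by rewrite pol_gfield; ring.
(* From rank 3 on, the quotient has positive rank [k.+1], so [g v] is an admissible product. *)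
apply: ndf; exists 1%N, (fun=> 2%N), (fun=> k.+1), (fun=> erefl).
exists (fun=> gfield mu), (fun=> v); do 2 (split; first by []).
split; first by move=> _; exact: killing_gfield.
split; first by [].
have -> : (fun i x y => \sum_(t < 1) tcast (erefl (2 + k.+1)%N) (tprod (gfield mu) v) i x y)
    = tprod (gfield mu) v.
  by apply/funext => i; apply/funext => x; apply/funext => y; rewrite big_ord1 tfield_cast_id.
apply: pol_inj => [||x y]; [exact: field_sym ff|exact: is_sym_sym|].
rewrite fE; apply: etrans (esym (pol_tprod (gfield mu) v x y)).
by rewrite pol_gfield mulrA.
Qed.

End KillingTensors.
Arguments tzero {R} k _ _ _.
Arguments leading_tensor {R} mu k a b _ _ _.

(** * Proof of the theorem *)

Section MainTheorem.
Variables (R : realType) (w1 w2 : R * R) (mu : R -> R -> R).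
Hypothesis basis : lattice_basis w1 w2.
Hypothesis smu : rsmooth mu.
Hypothesis pmu : lattice_periodic w1 w2 mu.
Local Notation C := R[i].
Local Notation is_sym := Defs.is_sym.
Local Notation I := (Complex 0 1 : C).
Local Notation conf x y := (expR (2 * mu x y))%:C%C.
Local Notation is_field := (is_field w1 w2).
Local Notation killing := (killing w1 w2 mu).
Local Notation leading_tensor := (leading_tensor mu).

Local Opaque pd.

Lemma is_sym_Zfield k c : is_sym (Zfield mu k c).
Proof.
move=> s i; apply/funext => x; apply/funext => y.
by rewrite /Zfield !weight_cardE weight_perm.
Qed.

Lemma pol_dsym0 k x y : pol (dsym mu (@tzero R k)) x y = 0.
Proof.
have s0 : tsmooth (@tzero R k) by move=> i; exact: csmooth_cst.
have E : tlin 0 0 (@tzero R k) (@tzero R k) = @tzero R k.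
  by apply/funext => i; apply/funext => a; apply/funext => b; rewrite /tlin mul0r addr0.
by rewrite -E (pol_dsym_tlin smu 0 0 x y s0 s0) !mul0r addr0.
Qed.

(** Writing [h = g v], the hypothesis [dh = -dL] for the leading tensor [L] becomes
    [g dv = -(k+1) g Z]; cancelling [g] makes [Z] the differential of [-v / (k+1)]. *)
Lemma potential_of_correction k a b (h : tfield R k.+1) :
  is_field h -> isotropic_zero h ->
  (forall x y, pol (dsym mu h) x y = - pol (dsym mu (leading_tensor k.+1 a b)) x y) ->
  potential w1 w2 mu (Zfield mu k (a + b, I * (a - b))).
Proof.
move=> fh h0 dh; set Z := Zfield _ _ _.
have kn0 : k.+1%:R != 0 :> C by rewrite pnatr_eq0.
have dE x y : pol (dsym mu h) x y =
    (conf x y)%:P * ((1 + 'X^2) * ((- k.+1%:R)%:P * pol Z x y)).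
  rewrite dh pol_dsym_leading_tensor// -/Z rmorphN rmorph_nat.
  by move: (_%:C%C%:P) (pol Z x y) k.+1%:R => e z K; ring.
have sZ : is_sym Z by exact: is_sym_Zfield.
move: @Z dE sZ.
case: k h fh h0 dh kn0 => [|k] h fh h0 dh kn0 Z dE sZ.
  (* For [k = 0] there is no quotient: [h] is a rank 1 field, hence zero, and [Z = 0] is the meaning
     of potential in rank 0. *)
  apply: (@pol_inj _ _ Z (@tzero R 0)) => // x y; rewrite pol0.
  have := dE x y; rewrite (tfield_rank1_eq0 (field_sym fh) h0) pol_dsym0.
  move=> E; have /eqP : (- 1%:R)%:P * pol Z x y = 0.
    by apply: (@metricM_inj _ mu x y); rewrite -E !mulr0.
  by rewrite mulf_eq0 polyC_eq0 oppr_eq0 (negbTE kn0) => /eqP.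
have [v fv hE] := metric_division smu pmu fh h0.
have dv x y : pol (dsym mu v) x y = (- k.+2%:R)%:P * pol Z x y.
  apply: (@metricM_inj _ mu x y).
  by rewrite -dE (pol_dsym_metricM smu (field_tsmooth fh) (field_tsmooth fv) hE).
exists (tlin (- k.+2%:R)^-1 0 v v); split; first exact: is_field_tlin.
apply: (pol_inj sZ (@is_sym_sym _ _ _)) => x y.
rewrite (pol_dsym_tlin smu _ _ x y (field_tsmooth fv) (field_tsmooth fv)).
by rewrite mul0r addr0 dv mulrA -polyCM mulVf ?mul1r// oppr_eq0.
Qed.

Lemma horner_real_pol k (f : tfield R k) x y : is_real_field f ->
  (pol f x y).[I] = ((pol f x y).[- I])^*%C.
Proof.
move=> rf; rewrite !horner_pol rmorph_sum; apply: eq_bigr => i _.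
rewrite rmorphM rmorphXn /=; congr (_ ^+ _ * _).
  by apply: complex_eqP; rewrite /= ?oppr0 ?opprK.
by have := rf i x y; case: (f i x y) => p q /= ->; rewrite oppr0.
Qed.

(** The two isotropic constants of [f] determine [a] and [b]; subtracting the corresponding leading
    tensor leaves a field that vanishes isotropically. *)
Lemma irreducible_potential k (f : tfield R k.+1) :
  is_real_field f -> irreducible_killing w1 w2 mu f ->
  exists c : C * C, real_pv c /\ c <> (0, 0) /\ potential w1 w2 mu (Zfield mu k c).
Proof.
move=> rf irr; have [kf _] := irr; have [ff df] := (killingP w1 w2 mu f).1 kf.
have NI : Complex 0 (- 1) = - I by apply: complex_eqP; rewrite /= ?oppr0.
have [|al alE] := @isotropic_constant _ _ _ _ basis smu pmu _ f (- 1) kf.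
  by rewrite sqrrN expr1n.
rewrite NI in alE.
have [|be beE] := @isotropic_constant _ _ _ _ basis smu pmu _ f 1 kf.
  by rewrite expr1n.
have be_conj : be = al^*%C.
  have := horner_real_pol 0 0 rf; rewrite alE beE rmorphM /= oppr0.
  by apply: mulfI; exact: conf_neq0.
(* The factor by which [horner_leading_tensor] scales [a] and [b]. *)
pose p := 2 ^+ k.+1 : C.
have p0 : p != 0 by rewrite expf_neq0// pnatr_eq0.
pose a := al / p; pose b := be / p.
(* Reality of [f] enters here: then [c = (2 Re a, -2 Im a)]. *)
have ab : b = a^*%C.
  have pc : p^*%C = p by rewrite /p -natrX conjc_nat.
  by rewrite /b /a be_conj rmorphM fmorphV /= pc.
pose h := tlin 1 (-1) f (leading_tensor k.+1 a b).
have fE := is_field_leading_tensor smu pmu k.+1 a b.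
have fh : is_field h by exact: is_field_tlin.
exists (a + b, I * (a - b)); split; [|split].
- rewrite ab; case: (a) => r s; split; rewrite /= ?addrN//; ring.
(* If [c = 0] then [a = b = 0], so [f] vanishes isotropically and is reducible. *)
- case=> /eqP; rewrite addr_eq0 => /eqP abN /eqP.
  rewrite mulf_eq0 eq_complex /= oner_eq0 andbF /= subr_eq0 abN eq_sym -addr_eq0.
  rewrite -mulr2n mulrn_eq0 /= => /eqP b0.
  have be0 : be = 0.
    by apply/eqP; move: b0 => /eqP; rewrite mulf_eq0 invr_eq0 (negbTE p0) orbF.
  have al0 : al = 0.
    by apply/eqP; move: abN => /eqP; rewrite b0 oppr0 mulf_eq0 invr_eq0 (negbTE p0) orbF.
  apply: (killing_isotropic_zero_reducible smu pmu kf) irr => x y t /isotropicP[->|->].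
    by rewrite beE be0 mulr0.
  by rewrite alE al0 mulr0.
apply: (@potential_of_correction k a b h fh).
  move=> x y t /isotropicP t2; rewrite pol_tlin hornerD !hornerM !hornerC.
  have [H1 H2] := horner_leading_tensor mu a b x y (ltn0Sn k).
  have pz z : p * (z / p) = z by rewrite mulrC divfK.
  case: t2 => ->; [rewrite H2 beE /b|rewrite H1 alE /a]; rewrite -/p pz;
    by rewrite mul1r mulN1r subrr.
move=> x y; rewrite (pol_dsym_tlin smu _ _ x y (field_tsmooth ff) (field_tsmooth fE)).
by rewrite df mulr0 add0r polyCN mulN1r.
Qed.

(** If [Z = dv], then [L - (k+1) g v] is Killing. It agrees with the leading tensor [L] at [i] and
    [-i], where reducible tensors vanish. *)
Lemma potential_irreducible k (c : C * C) :
  (forall j (f : tfield R j), (1 <= j < k.+1)%N -> ~ irreducible_killing w1 w2 mu f) ->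
  c <> (0, 0) -> potential w1 w2 mu (Zfield mu k c) ->
  exists f : tfield R k.+1, irreducible_killing w1 w2 mu f.
Proof.
move=> noirr c0.
(* The solution of [c = (a + b, i (a - b))]. *)
pose a := (c.1 - I * c.2) / 2; pose b := (c.1 + I * c.2) / 2.
have two0 : 2 != 0 :> C by rewrite pnatr_eq0.
have cE : c = (a + b, I * (a - b)).
  rewrite [LHS]surjective_pairing /a /b; congr pair; first by field.
  transitivity (- (I * I) * c.2); first by rewrite II opprK mul1r.
  by move: I => z; field.
have fL := is_field_leading_tensor smu pmu k.+1 a b.
move=> pZ; have [f kf fE] : exists2 f : tfield R k.+1, killing f &
    forall x y t, 1 + t ^+ 2 = 0 -> (pol f x y).[t] = (pol (leading_tensor k.+1 a b) x y).[t].
  move: pZ; rewrite cE; set Z := Zfield _ _ _ => pZ.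
  have dL x y := pol_dsym_leading_tensor smu k a b x y.
  move: @Z pZ dL fL; case: (k) => [|j] Z pZ dL fL.
    (* For [k = 0] potential means [Z = 0], so the leading tensor is itself Killing. *)
    exists (leading_tensor 1 a b) => //; apply/killingP; split=> // x y.
    by rewrite dL -/Z (pZ : Z = @tzero R 0) pol0 !mulr0.
  have [v [fv ZE]] := pZ; have sv := field_tsmooth fv.
  have fg := is_field_metricM smu pmu fv.
  exists (tlin 1 (- j.+2%:R) (leading_tensor j.+2 a b) (metricM mu v)).
    apply/killingP; split=> [|x y]; first exact: is_field_tlin.
    rewrite (pol_dsym_tlin smu _ _ x y (field_tsmooth fL) (field_tsmooth fg)) dL -/Z ZE.
    rewrite (pol_dsym_metricM smu (field_tsmooth fg) sv); last exact: pol_metricM.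
    rewrite rmorphN rmorph_nat mul1r mulNr; exact: subrr.
  move=> x y t t2; rewrite pol_tlin hornerD !hornerM !hornerC.
  by rewrite (isotropic_zero_metricM mu v x y t2) mulr0 addr0 mul1r.
(* The values at [-i] and [i] are nonzero multiples of [a] and [b], which are not both zero. *)
have nz : ~ isotropic_zero f.
  move=> f0; have [H1 H2] := horner_leading_tensor mu a b 0 0 (ltn0Sn k).
  have nz (z : C) : (expR (2 * k.+1%:R * mu 0 0))%:C%C * (2 ^+ k.+1 * z) = 0 -> z = 0.
    move=> /eqP; rewrite mulf_eq0 (negbTE (conf_neq0 _)) mulf_eq0.
    by rewrite (negbTE (expf_neq0 _ two0)) => /eqP.
  have a0 : a = 0 by apply: nz; rewrite -H1 -fE ?f0//; exact: isotropicNI.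
  have b0 : b = 0 by apply: nz; rewrite -H2 -fE ?f0//; exact: isotropicI.
  by apply: c0; rewrite cE a0 b0 addr0 subr0 mulr0.
exists f; split=> //; split.
  move=> df; apply: nz; apply: (isotropic_zero_decomposable _ df) => j h jk.
  exact: (isotropic_zero_killing noirr).
by move=> e d fd; apply: nz; exact: isotropic_zero_multiple_gfield fd.
Qed.

End MainTheorem.

Theorem theorem3p2 (R : realType) (w1 w2 : R * R) (mu : R -> R -> R)
  (m : nat) :
  lattice_basis w1 w2 -> rsmooth mu -> lattice_periodic w1 w2 mu -> (1 <= m)%N ->
  ((exists f : tfield R m,
      is_real_field f /\ irreducible_killing w1 w2 mu f) ->
   exists c : R[i] * R[i],
     real_pv c /\ c <> (0, 0) /\ potential w1 w2 mu (Zfield mu (m.-1) c))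
  /\
  ((forall (k : nat) (f : tfield R k), (1 <= k < m)%N ->
       ~ irreducible_killing w1 w2 mu f) ->
   (exists c : R[i] * R[i],
      c <> (0, 0) /\ potential w1 w2 mu (Zfield mu (m.-1) c)) ->
   exists f : tfield R m, irreducible_killing w1 w2 mu f).
Proof.
move=> basis smu pmu; case: m => [//|k] _; split.
  by move=> [f [rf irr]]; exact: (irreducible_potential basis smu pmu rf irr).
by move=> noirr [c [c0 pZ]]; exact: (potential_irreducible smu pmu noirr c0 pZ).
Qed.
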